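(* Let $[a,b]$ be a compact interval and $g:[a,b]\to\mathbb R$ a derivator with only finitely many discontinuity points in $[a,b]$. Then ${\rm P}_g$ is dense in $\mathrm{UC}_g([a,b])$ with respect to the supremum norm.
   Context: $\mathbb F\in\{\mathbb R,\mathbb C\}$. A derivator is a nondecreasing, left-continuous function $g:[a,b]\to\mathbb R$; $\mu_g$ is its Lebesgue–Stieltjes measure, characterized by $\mu_g([c,d))=g(d)-g(c)$ for $a\le c<d\le b$. For $x_0\in[a,b]$, the $g$-monomials centered at $x_0$ are $g_{x_0,0}\equiv1$ and recursively $g_{x_0,n}(x)=n\int_{[x_0,x)}g_{x_0,n-1}\,d\mu_g$ for $x\ge x_0$, $g_{x_0,n}(x)=-n\int_{[x,x_0)}g_{x_0,n-1}\,d\mu_g$ for $x<x_0$. A $g$-polynomial is a finite $\mathbb F$-linear combination of $g$-monomials; ${\rm P}_g$ is the space of $g$-polynomials (for any fixed $x_0$, $\{g_{x_0,n}\}_{n\ge0}$ spans ${\rm P}_g$). $\mathrm{UC}_g([a,b])$ is the Banach space, with the supremum norm, of uniformly $g$-continuous functions $f:[a,b]\to\mathbb F$: for every $\varepsilon>0$ there is $\delta>0$ such that $|g(x)-g(y)|<\delta$ implies $|f(x)-f(y)|<\varepsilon$ for all $x,y\in[a,b]$. *)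

(* Defs.v *)
From HB Require Import structures.
From mathcomp Require Import all_boot all_order all_algebra.
From mathcomp Require Import all_classical all_reals all_analysis.
From mathcomp Require Import complex.
Set Implicit Arguments. Unset Strict Implicit. Unset Printing Implicit Defensive.
Import Order.TTheory GRing.Theory Num.Theory.
Import numFieldNormedType.Exports.
Local Open Scope classical_set_scope.
Local Open Scope ring_scope.

(* g-monomials centered at x0, w.r.t. the measure mu (= mu_g):
   g_{x0,0} = 1,
   g_{x0,n+1}(x) = (n+1) \int_[x0,x) g_{x0,n} dmu      if x0 <= x,
                 = -(n+1) \int_[x,x0) g_{x0,n} dmu     if x < x0. *)
Fixpoint gmono (R : realType) (mu : {measure set R -> \bar R}) (x0 : R) (n : nat)
  : R -> R :=
  match n with
  | 0 => fun _ => 1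
  | n'.+1 => fun x =>
      if x0 <= x then n'.+1%:R * (\int[mu]_(t in [set` `[x0, x[]) gmono mu x0 n' t)
      else - (n'.+1%:R * (\int[mu]_(t in [set` `[x, x0[]) gmono mu x0 n' t))
  end.

Definition is_gpolyR (R : realType) (mu : {measure set R -> \bar R}) (a b : R)
  (p : R -> R) : Prop :=
  exists s : seq (R * nat * R),
    (forall e, e \in s -> a <= e.1.1 <= b) /\
    forall x, p x = \sum_(e <- s) e.2 * gmono mu e.1.1 e.1.2 x.

Definition is_gpolyC (R : realType) (mu : {measure set R -> \bar R}) (a b : R)
  (p : R -> R[i]) : Prop :=
  exists s : seq (R * nat * R[i]),
    (forall e, e \in s -> a <= e.1.1 <= b) /\
    forall x, p x = \sum_(e <- s) e.2 * (gmono mu e.1.1 e.1.2 x)%:C%C.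

Definition derivator (R : realType) (a b : R) (g : R -> R) : Prop :=
  (forall x y, a <= x -> x <= y -> y <= b -> g x <= g y) /\
  (forall x, a < x -> x <= b -> g @ at_left x --> g x).

Definition discont_points (R : realType) (a b : R) (g : R -> R) : set R :=
  [set x | a <= x <= b /\ ~ (g @ within `[a, b] (nbhs x) --> g x)].

Definition unif_g_contR (R : realType) (a b : R) (g : R -> R) (f : R -> R) : Prop :=
  forall eps : R, 0 < eps -> exists2 delta : R, 0 < delta &
    forall x y, a <= x <= b -> a <= y <= b ->
      `|g x - g y| < delta -> `|f x - f y| < eps.

Definition unif_g_contC (R : realType) (a b : R) (g : R -> R) (f : R -> R[i]) : Prop :=
  forall eps : R, 0 < eps -> exists2 delta : R, 0 < delta &
    forall x y, a <= x <= b -> a <= y <= b ->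
      `|g x - g y| < delta -> `|f x - f y| < eps%:C%C.

(* Main.v *)
Require Import Defs.
From HB Require Import structures.
From mathcomp Require Import all_boot all_order all_algebra.
From mathcomp Require Import all_classical all_reals all_analysis.
From mathcomp Require Import complex.
From mathcomp Require Import measurable_realfun ring lra.
Import Order.TTheory GRing.Theory Num.Theory.
Import numFieldNormedType.Exports.
Local Open Scope classical_set_scope.
Local Open Scope ring_scope.

(** Let [T f x] be the integral of [f] over [[a, x)], so that the g-monomials centred at [a] are the [n! T^n 1].  If [g] is continuous they are the powers of [g - g a] and Weierstrass' theorem applies.  Otherwise argue by induction on the number of jumps.  Remove the jump [c] at [d], let [T'] be the resulting integration operator and [chi] the indicator of [x > d]; then [T = T' + c chi (evaluation at d)].  The operator [L u = T' u + c chi u] satisfies [L T' = T L] and [L 1 = T 1], so it maps the g'-polynomials into the g-polynomials and, by continuity and induction, all uniformly g'-continuous functions into the closure [V] of the g-polynomials.  For [W] uniformly g-continuous and vanishing on [[a, d]], extend [W] to the left of [d] by a steep g'-continuous ramp: its image under [L] is uniformly close to [(T + c) W], whence [(T + c) W] is in [V].  A Neumann series, which converges because [T^n 1] decays faster than any geometric sequence (also proved by induction, from [T^(n+1) 1 = L (T'^n 1)]), gives that [W] is in [V].  Then [c chi u] and hence [T' u = L u - c chi u] are in [V] for [u] uniformly g'-continuous; thus [V] contains every uniformly g'-continuous function, and a uniformly g-continuous [f] is [f (min x d)] plus a function vanishing on [[a, d]]. *)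

(** * Bernstein polynomials and elementary estimates on powers *)

Section PolynomialEstimates.
Set Implicit Arguments.
Unset Strict Implicit.
Context {R : realType}.
Implicit Types (phi psi : nat -> R) (t c : R).

(* The Bernstein polynomial [\sum_k phi k 'C(n, k) 'X^k (1 - 'X)^(n - k)], where [phi k] plays the role of [F (k / n)]; the Pascal-type recursion makes the variance identity a one-line induction. *)
Fixpoint bernstein n phi : {poly R} :=
  if n is n'.+1 then
    (1 - 'X) * bernstein n' phi + 'X * bernstein n' (phi \o S)
  else (phi 0)%:P.

Lemma bernsteinS n phi t : (bernstein n.+1 phi).[t] =
  (1 - t) * (bernstein n phi).[t] + t * (bernstein n (phi \o S)).[t].
Proof. by rewrite /= !hornerE. Qed.

(** Linearity in [phi] and reproduction of constants, combined: this rewrites [v] minus a Bernstein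
    polynomial as a single one, and also evaluates the quadratic majorant in [bernstein_approx]. *)
Lemma bernstein_affine n c1 c2 phi t :
  (bernstein n (fun k => c1 + c2 * phi k)).[t] = c1 + c2 * (bernstein n phi).[t].
Proof.
elim: n phi => [|n IH] phi; first by rewrite /= !hornerE.
rewrite !bernsteinS IH (_ : _ \o S = fun k => c1 + c2 * (phi \o S) k)// IH.
ring.
Qed.

(** The shift by [S] turns [c] into [c - 1], so the induction needs [c] free; at [c = n t] only the
    binomial variance [n t (1 - t)] is left. *)
Lemma bernstein_variance n t c :
  (bernstein n (fun k => (k%:R - c) ^+ 2)).[t] =
  n%:R * t * (1 - t) + (n%:R * t - c) ^+ 2.
Proof.
elim: n c => [|n IH] c; first by rewrite /= !hornerE.
rewrite bernsteinS IH (_ : _ \o S = fun k => (k%:R - (c - 1)) ^+ 2).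
  rewrite IH -natr1; ring.
by apply/funext => k /=; rewrite -natr1; ring.
Qed.

Lemma bernstein_le_norm n phi psi t : 0 <= t <= 1 ->
  (forall k, (k <= n)%N -> `|phi k| <= psi k) ->
  `|(bernstein n phi).[t]| <= (bernstein n psi).[t].
Proof.
move=> /andP[t0 t1]; elim: n phi psi => [|n IH] phi psi H.
  by rewrite /= !hornerE H.
rewrite !bernsteinS; apply: le_trans (ler_normD _ _) _.
rewrite !normrM (ger0_norm t0) (@ger0_norm _ (1 - t)) ?subr_ge0//.
rewrite lerD// ler_wpM2l ?subr_ge0//; apply: IH => k kn; apply: H.
  exact: leqW.
by [].
Qed.

Lemma bernstein_approx n phi t v e A : 0 <= t <= 1 ->
  (forall k, (k <= n)%N -> `|v - phi k| <= e + A * (k%:R - n%:R * t) ^+ 2) ->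
  `|v - (bernstein n phi).[t]| <= e + A * (n%:R * t * (1 - t)).
Proof.
move=> t01 H.
have := @bernstein_le_norm n (fun k => v + (-1) * phi k) _ t t01
  (fun k kn => eq_ind_r (fun z => `|v + z| <= _) (H k kn) (mulN1r (phi k))).
by rewrite !bernstein_affine mulN1r bernstein_variance subrr expr0n addr0.
Qed.

(** Together with [pow_lip], this makes the local error in [prim_gfunX] quadratic in the increment
    of [gfun]. *)
Lemma pow_taylor1 n (B : R) : 0 <= B -> exists2 C, 0 <= C &
  forall u v, 0 <= u <= B -> 0 <= v <= B ->
  `|u ^+ n.+1 - v ^+ n.+1 - n.+1%:R * v ^+ n * (u - v)| <= C * (u - v) ^+ 2.
Proof.
move=> B0; elim: n => [|n [C C0 IH]].
  exists 0 => // u v _ _; rewrite !expr1 expr0 mulr1 mul1r subrr normr0 mul0r//.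
exists (B * C + n.+1%:R * B ^+ n).
  by rewrite addr_ge0 ?mulr_ge0 ?exprn_ge0.
move=> u v uB vB; have {}IH := IH u v uB vB.
have -> : u ^+ n.+2 - v ^+ n.+2 - n.+2%:R * v ^+ n.+1 * (u - v) =
    u * (u ^+ n.+1 - v ^+ n.+1 - n.+1%:R * v ^+ n * (u - v)) +
    n.+1%:R * v ^+ n * (u - v) ^+ 2.
  by rewrite -(natr1 n.+1) !exprS; ring.
move: uB vB => /andP[u0 uB] /andP[v0 vB].
apply: le_trans (ler_normD _ _) _; rewrite [leRHS]mulrDl; apply: lerD.
  rewrite normrM (ger0_norm u0) -[leRHS]mulrA.
  by apply: ler_pM => //.
rewrite ger0_norm; last by rewrite mulr_ge0 ?sqr_ge0// mulr_ge0 ?exprn_ge0.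
rewrite ler_wpM2r ?sqr_ge0// ler_wpM2l// lerXn2r ?nnegrE//.
Qed.

Lemma pow_lip n (B : R) : 0 <= B -> exists2 C, 0 <= C &
  forall u v, 0 <= u <= B -> 0 <= v <= B ->
  `|u ^+ n - v ^+ n| <= C * `|u - v|.
Proof.
move=> B0; elim: n => [|n [C C0 IH]].
  by exists 0 => // u v _ _; rewrite !expr0 subrr normr0 mul0r.
exists (B * C + B ^+ n); first by rewrite addr_ge0 ?mulr_ge0 ?exprn_ge0.
move=> u v uB vB; have {}IH := IH u v uB vB.
have -> : u ^+ n.+1 - v ^+ n.+1 = u * (u ^+ n - v ^+ n) + v ^+ n * (u - v).
  by rewrite !exprS; ring.
move: uB vB => /andP[u0 uB] /andP[v0 vB].
apply: le_trans (ler_normD _ _) _; rewrite [leRHS]mulrDl; apply: lerD.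
  by rewrite normrM (ger0_norm u0) -[leRHS]mulrA; apply: ler_pM.
rewrite normrM ger0_norm ?exprn_ge0// ler_wpM2r// lerXn2r ?nnegrE//.
Qed.

Lemma clamp_lip (u v : R) :
  `|Num.max 0 (Num.min 1 u) - Num.max 0 (Num.min 1 v)| <= `|u - v|.
Proof.
case: (leP 1 u) => u1; case: (leP 1 v) => v1; rewrite ?(max_idPr ler01);
  case: (leP 0 u) => u0; case: (leP 0 v) => v0;
  rewrite ler_norml; case: (ger0P (u - v)) => ?; lra.
Qed.

End PolynomialEstimates.

(** * Integration against [mu] restricted to a set *)

Section StieltjesIntegration.
Set Implicit Arguments.
Unset Strict Implicit.
Context (R : realType) (a b : R) (mu : {measure set R -> \bar R}).
Hypothesis le_ab : a <= b.
Hypothesis mu_fin : (mu [set` `[a, b[] < +oo)%E.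
Implicit Types (D : set R) (f h : R -> R).

(* [D] stands for the measure [mu] restricted to [D]: discarding an atom of [mu] is discarding a point of [D]. *)
Definition icell D x y : set R := [set` `[x, y[] `&` D.
Definition mass D x y : R := fine (mu (icell D x y)).
Definition prim D f x : R := \int[mu]_(t in icell D a x) f t.
(** The normalised derivator of the restricted measure; for the full domain it is [g - g a] on
    [[a, b]], so g-continuity can be phrased through [mu] alone. *)
Definition gfun D x : R := mass D a x.

(** A class stable under sums, products and [prim], on which every integral over a cell is
    finite. *)
Definition regular f :=
  measurable_fun [set` `[a, b]] f /\ exists M, forall x, a <= x <= b -> `|f x| <= M.

Lemma icell_measurable D x y : measurable D -> measurable (icell D x y).
Proof. by move=> mD; apply: measurableI => //; exact: measurable_itv. Qed.

Lemma icell_sub D x y : a <= x -> y <= b -> icell D x y `<=` [set` `[a, b[].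
Proof.
move=> ax yb t [/=]; rewrite !in_itv/= => /andP[xt ty] _.
by rewrite (le_trans ax xt) (lt_le_trans ty yb).
Qed.

Lemma icell_sub_closed D x y : a <= x -> y <= b -> icell D x y `<=` [set` `[a, b]].
Proof.
move=> ax yb t ct; have /= := icell_sub ax yb ct.
by rewrite !in_itv/= => /andP[-> /ltW].
Qed.

Lemma icell_fin D x y : measurable D -> a <= x -> y <= b ->
  (mu (icell D x y) < +oo)%E.
Proof.
move=> mD ax yb; apply: le_lt_trans mu_fin; apply: le_measure; rewrite ?inE.
- exact: icell_measurable.
- exact: measurable_itv.
- exact: icell_sub.
Qed.

Lemma regular_integrable f (A : set R) : measurable A -> A `<=` [set` `[a, b[] ->
  regular f -> mu.-integrable A (EFin \o f).
Proof.
move=> mA Aab [mf [M fM]].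
have Aab' : A `<=` [set` `[a, b]].
  by move=> t /Aab /=; rewrite !in_itv/= => /andP[-> /ltW].
apply: measurable_bounded_integrable => //.
- by apply: le_lt_trans mu_fin; apply: le_measure; rewrite ?inE//; exact: measurable_itv.
- by apply: measurable_funS mf => //; exact: measurable_itv.
- exists M; split; first exact: num_real.
  move=> N MN x /= /Aab' /=; rewrite in_itv/= => xab.
  exact: le_trans (fM _ xab) (ltW MN).
Qed.

Lemma le_prim_norm f (A : set R) M : measurable A -> A `<=` [set` `[a, b[] ->
  regular f -> (forall x, A x -> `|f x| <= M) ->
  `|\int[mu]_(t in A) f t| <= M * fine (mu A).
Proof.
move=> mA Aab rf fM.
have fi := regular_integrable mA Aab rf.
have rc : regular (fun=> M).
  by split; [exact: measurable_cst|exists `|M|].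
have ci := regular_integrable mA Aab rc.
apply: le_trans (le_normr_Rintegral mA fi) _.
rewrite -Rintegral_cst//; apply: le_Rintegral => //.
have ra : regular (fun x => `|f x|).
  case: rf => mf [N fN]; split; first exact: measurableT_comp.
  by exists N => x /fN; rewrite normr_id.
exact: (regular_integrable mA Aab ra).
Qed.

Lemma regular_cst c : regular (fun=> c).
Proof. by split; [exact: measurable_cst|exists `|c|]. Qed.

Lemma regularD f h : regular f -> regular h -> regular (fun x => f x + h x).
Proof.
move=> [mf [M fM]] [mh [N hN]]; split; first exact: measurable_funD.
exists (M + N) => x xab; apply: le_trans (ler_normD _ _) _.
by rewrite lerD ?fM ?hN.
Qed.

Lemma regularM f h : regular f -> regular h -> regular (fun x => f x * h x).
Proof.
move=> [mf [M fM]] [mh [N hN]]; split; first exact: measurable_funM.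
exists (M * N) => x xab; rewrite normrM.
by rewrite ler_pM ?fM ?hN.
Qed.

Lemma eq_regular f h : (forall x, a <= x <= b -> f x = h x) -> regular f -> regular h.
Proof.
move=> fh [mf [M fM]]; split.
  by apply: eq_measurable_fun mf => x; rewrite inE/= in_itv/= => /fh.
by exists M => x xab; rewrite -fh// fM.
Qed.

Lemma eq_prim D f h x : x <= b -> (forall t, a <= t <= b -> f t = h t) ->
  prim D f x = prim D h x.
Proof.
move=> xb fh; apply: eq_Rintegral => t; rewrite inE => -[/=].
by rewrite in_itv/= => /andP[at_ tx] _; apply: fh; rewrite at_ (ltW (lt_le_trans tx xb)).
Qed.

(** * Primitives and distribution function for a fixed domain *)

Section OneDomain.
Variable D : set R.
Hypothesis mD : measurable D.
Local Notation cell := (icell D).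
Local Notation T := (prim D).
Local Notation G := (gfun D).
Local Notation m := (mass D).

Lemma cell_integrable f x y : a <= x -> y <= b -> regular f ->
  mu.-integrable (cell x y) (EFin \o f).
Proof.
by move=> ax yb rf; apply: regular_integrable => //;
  [exact: icell_measurable|exact: icell_sub].
Qed.

Lemma primD f h x : x <= b -> regular f -> regular h ->
  T (fun t => f t + h t) x = T f x + T h x.
Proof.
move=> xb rf rh; rewrite /prim RintegralD//; first exact: icell_measurable.
- exact: cell_integrable.
- exact: cell_integrable.
Qed.

Lemma primZ c f x : x <= b -> regular f -> T (fun t => c * f t) x = c * T f x.
Proof.
move=> xb rf; rewrite /prim RintegralZl//; first exact: icell_measurable.
exact: cell_integrable.
Qed.

Lemma prim_at_a f : T f a = 0.
Proof.
rewrite /prim (_ : cell a a = set0) ?Rintegral_set0//.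
by rewrite /icell set_itvco0 ?set0I.
Qed.

Lemma icell_cat x y z : x <= y -> y <= z -> cell x z = cell x y `|` cell y z.
Proof.
move=> xy yz; rewrite /icell -setIUl; congr (_ `&` _).
apply/seteqP; split => t /=; rewrite !in_itv/=.
  move=> /andP[xt tz]; case: (ltP t y) => ty; [left|right].
    by rewrite xt.
  by rewrite tz.
move=> [|] /andP[]; first by move=> -> /lt_le_trans ->.
by move=> /(le_trans xy) -> ->.
Qed.

Lemma icell_disj x y z : [disjoint cell x y & cell y z].
Proof.
apply/disj_setPS => t [[/=]]; rewrite in_itv/= => /andP[_ ty] _ [/=].
by rewrite in_itv/= leNgt ty.
Qed.

Lemma icell_catI x y z : cell x y `&` cell y z = set0.
Proof. exact: (disj_set2P (icell_disj x y z)). Qed.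

Lemma prim_split f x y : a <= x -> x <= y -> y <= b -> regular f ->
  T f y = T f x + \int[mu]_(t in cell x y) f t.
Proof.
move=> ax xy yb rf; rewrite /prim (icell_cat ax xy) Rintegral_setU//.
- exact: icell_measurable.
- exact: icell_measurable.
- by rewrite -(icell_cat ax xy); exact: cell_integrable.
- exact: icell_disj.
Qed.

Lemma mass_ge0 x y : 0 <= m x y. Proof. exact: fine_ge0. Qed.

Lemma fin_num_cell x y : a <= x -> y <= b -> mu (cell x y) \is a fin_num.
Proof. by move=> ax yb; rewrite ge0_fin_numE//; exact: icell_fin. Qed.

Lemma gfun_split x y : a <= x -> x <= y -> y <= b -> G y = G x + m x y.
Proof.
move=> ax xy yb; rewrite /gfun /mass (icell_cat ax xy) measureU/=.
- by rewrite fineD// fin_num_cell// (le_trans xy).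
- exact: icell_measurable.
- exact: icell_measurable.
- exact: icell_catI.
Qed.

Lemma gfun_at_a : G a = 0.
Proof. by rewrite /gfun /mass /icell set_itvco0 ?set0I ?measure0. Qed.

Lemma gfun_nd x y : a <= x -> x <= y -> y <= b -> G x <= G y.
Proof. by move=> ax xy yb; rewrite (gfun_split ax xy yb) lerDl mass_ge0. Qed.

Lemma gfun_ge0 x : 0 <= G x. Proof. exact: mass_ge0. Qed.

Lemma le_cell_norm f M x y : a <= x -> y <= b -> regular f ->
  (forall t, x <= t < y -> `|f t| <= M) -> `|\int[mu]_(t in cell x y) f t| <= M * m x y.
Proof.
move=> ax yb rf fM; apply: le_prim_norm => //.
- exact: icell_measurable.
- exact: icell_sub.
- by move=> t [/=]; rewrite in_itv/= => /fM.
Qed.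

Lemma prim_lip f M x y : a <= x <= b -> a <= y <= b -> regular f ->
  (forall t, a <= t <= b -> `|f t| <= M) -> `|T f x - T f y| <= M * `|G x - G y|.
Proof.
wlog xy : x y / x <= y.
  move=> H xab yab rf fM; case: (leP x y) => [|/ltW] xy; first exact: H.
  by rewrite distrC [`|G x - _|]distrC; exact: H.
move=> /andP[ax xb] /andP[ay yb] rf fM; rewrite distrC [`|G x - _|]distrC.
rewrite (prim_split ax xy yb rf) (gfun_split ax xy yb).
rewrite addrAC subrr add0r addrAC subrr add0r (ger0_norm (mass_ge0 _ _)).
apply: le_cell_norm => // t /andP[xt ty]; apply: fM.
by rewrite (le_trans ax xt) (ltW (lt_le_trans ty yb)).
Qed.

Lemma le_prim f h x : x <= b -> regular f -> regular h ->
  (forall t, a <= t <= b -> f t <= h t) -> T f x <= T h x.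
Proof.
move=> xb rf rh fh; apply: le_Rintegral.
- exact: icell_measurable.
- exact: cell_integrable.
- exact: cell_integrable.
- move=> t ct; have /= := icell_sub_closed (lexx _) xb ct.
  by rewrite in_itv/= => /fh.
Qed.

Lemma prim_norm_le f M x : a <= x <= b -> regular f ->
  (forall t, a <= t <= b -> `|f t| <= M) -> `|T f x| <= M * G b.
Proof.
move=> /andP[ax xb] rf fM.
have M0 : 0 <= M by apply: le_trans (fM a _); rewrite ?lexx.
apply: le_trans (_ : M * G x <= _); last first.
  by rewrite ler_wpM2l// gfun_nd.
apply: le_cell_norm => // t /andP[at_ tx]; apply: fM.
by rewrite at_ (ltW (lt_le_trans tx xb)).
Qed.

Lemma gfun_measurable : measurable_fun [set` `[a, b]] G.
Proof.
(* Composing with the projection onto [[a, b]] gives a function that is monotone on the whole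
   line. *)
pose c x := Num.max a (Num.min x b).
have cab x : a <= c x <= b by rewrite /c le_max lexx/= ge_max le_ab ge_min lexx orbT.
have cid x : a <= x <= b -> c x = x.
  by move=> /andP[ax xb]; rewrite /c (min_idPl xb) (max_idPr ax).
apply: (eq_measurable_fun (fun x => G (c x))).
  by move=> x; rewrite inE/= in_itv/= => /cid ->.
apply: nondecreasing_measurable; first exact: measurable_itv.
move=> x y xy; apply: gfun_nd.
- by case/andP: (cab x).
- by rewrite /c; apply: le_max2 => //; exact: le_min2.
- by case/andP: (cab y).
Qed.

(** * Uniformly g-continuous functions are bounded and measurable *)

Definition ucont f := unif_g_contR a b G f.

(** The range of [G] is bounded, so [[a, b]] splits into finitely many classes on which the integer
    part of [G / d] is constant; [f] oscillates by less than 1 on each. *)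
Lemma ucont_bounded f : ucont f -> exists M, forall x, a <= x <= b -> `|f x| <= M.
Proof.
move=> /(_ 1 ltr01)[d d0 fd].
pose cl x := Num.truncn (G x / d).
(* A representative of each class; the default [a] is taken only for empty classes. *)
pose r n := xget a [set x | a <= x <= b /\ cl x = n].
pose N := (Num.truncn (G b / d)).+1.
exists (\sum_(i < N) `|f (r i)| + 1) => x xab.
have Gd0 y : 0 <= G y / d by rewrite divr_ge0 ?gfun_ge0// ltW.
have clN : (cl x < N)%N.
  rewrite ltnS /cl; apply: le_truncn.
  by rewrite ler_pM2r ?invr_gt0//; case/andP: xab => *; exact: gfun_nd.
have [rab rcl] : a <= r (cl x) <= b /\ cl (r (cl x)) = cl x.
  by rewrite /r; case: xgetP => [y -> []//|/(_ x)]; case.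
have : `|f x - f (r (cl x))| < 1.
  apply: fd => //; set y := r (cl x) in rab rcl *.
  have /andP[h1 h2] := truncn_itv (Gd0 x).
  have /andP[h3 h4] := truncn_itv (Gd0 y).
  rewrite -/(cl x) -/(cl y) rcl in h1 h2 h3 h4.
  rewrite -(ltr_pM2r (_ : 0 < d^-1)) ?invr_gt0// divff ?gt_eqF//.
  rewrite -[X in _ * X](@ger0_norm _ d^-1) ?invr_ge0 ?(ltW d0)//.
  rewrite -normrM mulrBl; move: h1 h2 h3 h4; rewrite -[in X in _ -> X]natr1.
  by rewrite ltr_norml; lra.
move=> fxr; have : `|f (r (cl x))| <= \sum_(i < N) `|f (r i)|.
  rewrite (bigD1 (Ordinal clN))//= lerDl.
  by apply: sumr_ge0.
have := ler_normD (f x - f (r (cl x))) (f (r (cl x))); rewrite subrK.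
move: fxr; lra.
Qed.

(** Each set [f > c] is the preimage under [G] of an open set, namely a union of balls on whose
    preimage [f] stays above [c]; measurability then comes from that of [G]. *)
Lemma ucont_regular f : ucont f -> regular f.
Proof.
move=> uf; split; last exact: ucont_bounded.
move=> mI; apply: (measurability _ (RGenOInfty.measurableE R)) => //.
move=> /= _ [_ [c ->] <-].
pose U := \bigcup_(p in [set p : R * R | a <= p.1 <= b /\ 0 < p.2 /\
    forall y, a <= y <= b -> `|G p.1 - G y| < p.2 -> c < f y]) ball (G p.1) p.2.
have -> : [set` `[a, b]] `&` f @^-1` [set` `]c, +oo[] = [set` `[a, b]] `&` G @^-1` U.
  apply/seteqP; split => x [/=]; rewrite in_itv/= => xab.
    rewrite in_itv/= andbT => cf; split => //.
    have cf0 : 0 < f x - c by rewrite subr_gt0.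
    have [d d0 fd] := uf _ cf0.
    exists (x, d) => /=; last exact: ballxx.
    split => //; split => // y yab /(fd _ _ xab yab).
    by rewrite ltr_norml; lra.
  move=> [[y d] /= [yab [d0 H]]]; rewrite /ball/= => xU.
  by split => //; rewrite /= in_itv/= andbT; exact: H.
apply: gfun_measurable => //.
apply: open_measurable; apply: bigcup_open => p _; exact: ball_open.
Qed.

Lemma prim_ucont f : regular f -> ucont (T f).
Proof.
move=> rf; have [_ [M fM]] := rf.
have M0 : 0 <= M by apply: le_trans (fM a _); rewrite ?lexx.
move=> e e0; exists (e / (M + 1)); first by rewrite divr_gt0// ltr_wpDl.
move=> x y xab yab; rewrite ltr_pdivlMr ?ltr_wpDl// => h.
apply: le_lt_trans (prim_lip xab yab rf fM) _.
apply: le_lt_trans h; rewrite mulrC ler_wpM2l//; lra.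
Qed.

Lemma prim_regular f : regular f -> regular (T f).
Proof. by move=> /prim_ucont /ucont_regular. Qed.

End OneDomain.

(** * Cells of small mass next to a point *)

Lemma small_cell (F : nat -> set R) e : (forall n, measurable (F n)) ->
  (mu (F 0%N) < +oo)%E -> (forall n m, (n <= m)%N -> F m `<=` F n) ->
  \bigcap_n F n = set0 -> 0 < e -> exists n, fine (mu (F n)) < e.
Proof.
move=> mF F0 Fd Fcap e0.
have /(_ _) c := @nonincreasing_cvg_mu _ _ _ mu F F0 mF.
have {}c : (mu \o F) x @[x --> \oo] --> 0%:E.
  have <- : mu (\bigcap_n F n) = 0%:E by rewrite Fcap measure0.
  apply: c; first by rewrite Fcap.
  by move=> n m nm; apply/subsetPset; exact: Fd.
move/fine_cvgP : c => [_] /cvgrPdist_lt /(_ _ e0)[n _ /(_ n (leqnn n))] /=.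
rewrite sub0r normrN ger0_norm ?fine_ge0// => h.
by exists n.
Qed.

(** Once [d] is removed, the cells shrinking to [d] from the right have empty intersection, so
    continuity from above applies. *)
Lemma mass_right_small D d e : measurable D -> a <= d -> d < b -> 0 < e ->
  exists2 y, d < y <= b & mass (D `\ d) d y < e.
Proof.
move=> mD ad db e0.
pose u n : R := d + (b - d) / n.+1%:R.
have ub n : d < u n <= b.
  rewrite /u ltrDl divr_gt0 ?subr_gt0//= -lerBrDl ler_pdivrMr// ler_peMr ?ler1n//.
  by rewrite subr_ge0 ltW.
have mDd : measurable (D `\ d) by apply: measurableD.
have [||||n h] := @small_cell (fun n => icell (D `\ d) d (u n)) e _ _ _ _ e0.
- by move=> n; exact: icell_measurable.
- by apply: icell_fin => //; case/andP: (ub 0%N).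
- move=> n m nm t [/= ]; rewrite !in_itv/= => /andP[dt tu] Dt; split => //=.
  rewrite in_itv/= dt (lt_le_trans tu)// lerD2l ler_wpM2l ?subr_ge0 ?(ltW db)//.
  by rewrite lef_pV2 ?posrE// ler_nat.
- apply/seteqP; split => // t tF.
  have [/=] := tF 0%N I; rewrite in_itv/= => /andP[dt _] [_ /= td].
  have {}dt : 0 < t - d by rewrite subr_gt0 lt_neqAle dt andbT eq_sym; apply/eqP.
  (* This index makes the right endpoint [u n] smaller than [t], a contradiction. *)
  have := tF (Num.truncn ((b - d) / (t - d))) I.
  move=> [/=]; rewrite in_itv/= => /andP[_ +] _.
  rewrite -ltrBlDl ltr_pdivlMr// mulrC -ltr_pdivlMr// ltNge => /negP; apply.
  apply: ltW; have /truncn_itv/andP[_ //] : 0 <= (b - d) / (t - d).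
  by rewrite divr_ge0 ?(ltW dt)// subr_ge0 ltW.
by exists (u n).
Qed.

(** Half-open cells ending at [c] exclude [c], so they shrink to the empty set without removing a
    point: this is left continuity of [gfun]. *)
Lemma mass_left_small D c e : measurable D -> a < c -> c <= b -> 0 < e ->
  exists2 y, a <= y < c & mass D y c < e.
Proof.
move=> mD ac cb e0.
pose u n : R := c - (c - a) / n.+1%:R.
have ub n : a <= u n < c.
  rewrite /u ltrBlDr ltrDl divr_gt0 ?subr_gt0// andbT lerBrDr -lerBrDl.
  by rewrite ler_pdivrMr// ler_peMr ?ler1n// subr_ge0 ltW.
have [||||n h] := @small_cell (fun n => icell D (u n) c) e _ _ _ _ e0.
- by move=> n; exact: icell_measurable.
- by apply: icell_fin => //; case/andP: (ub 0%N).
- move=> n m nm t [/= ]; rewrite !in_itv/= => /andP[ut tc] Dt; split => //=.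
  rewrite in_itv/= tc (le_trans _ ut)// lerD2l lerN2 ler_wpM2l ?subr_ge0 ?(ltW ac)//.
  by rewrite lef_pV2 ?posrE// ler_nat.
- apply/seteqP; split => // t tF.
  have [/=] := tF 0%N I; rewrite in_itv/= => /andP[_ tc] _.
  have {}dt : 0 < c - t by rewrite subr_gt0.
  have := tF (Num.truncn ((c - a) / (c - t))) I.
  move=> [/=]; rewrite in_itv/= => /andP[+ _] _.
  rewrite lerBlDr -lerBlDl ler_pdivlMr// mulrC -ler_pdivlMr// leNgt => /negP; apply.
  have /truncn_itv/andP[_ //] : 0 <= (c - a) / (c - t).
  by rewrite divr_ge0 ?(ltW dt)// subr_ge0 ltW.
by exists (u n).
Qed.

(** * Atoms and their removal from the domain *)

Definition atom D d : R := fine (mu ([set d] `&` D)).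

Lemma atom_measurable D d : measurable D -> measurable ([set d] `&` D).
Proof. by move=> mD; apply: measurableI. Qed.

Lemma atom_sub D d : a <= d < b -> [set d] `&` D `<=` [set` `[a, b[].
Proof. by move=> dab t [-> _] /=; rewrite in_itv. Qed.

Lemma cell_remove D d x y : x <= d -> d < y ->
  icell D x y = icell (D `\ d) x y `|` ([set d] `&` D).
Proof.
move=> xd dy; apply/seteqP; split => t.
  move=> [/= xty Dt]; have [td|/eqP td] := eqVneq t d; last by left.
  by right; split.
move=> [[? [? _]]//|[/= -> Dd]]; split => //=.
by rewrite in_itv/= xd.
Qed.

Lemma cell_remove_out D d x y : y <= d -> icell D x y = icell (D `\ d) x y.
Proof.
move=> yd; apply/seteqP; split => t; last by move=> [? [? _]].
move=> [/= xty Dt]; split => //; split => //= td.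
by move: xty; rewrite td in_itv/= ltNge yd andbF.
Qed.

Lemma mass_remove D d x y : measurable D -> a <= x -> x <= d -> d < y -> y <= b ->
  mass D x y = mass (D `\ d) x y + atom D d.
Proof.
move=> mD ax xd dy yb; have mDd : measurable (D `\ d) by apply: measurableD.
rewrite /mass (cell_remove D xd dy) measureU/= ?fineD//.
- exact: fin_num_cell.
- rewrite ge0_fin_numE//; apply: le_lt_trans mu_fin.
  apply: le_measure; rewrite ?inE//; first exact: atom_measurable.
  by apply: atom_sub; rewrite (le_trans ax xd) (lt_le_trans dy yb).
- exact: icell_measurable.
- exact: atom_measurable.
- by apply/seteqP; split => // t [[_ [_ /= td]] [/=]].
Qed.

(** The cell from [a] to [x] contains [d] exactly when [d < x], so the jump is felt strictly to the
    right of [d]. *)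
Lemma gfun_remove D d x : measurable D -> a <= d -> x <= b ->
  gfun D x = gfun (D `\ d) x + (if d < x then atom D d else 0).
Proof.
move=> mD ad xb; case: ltP => dx; first exact: mass_remove.
by rewrite addr0 /gfun /mass (cell_remove_out D a dx).
Qed.

Lemma prim_remove D d f x : measurable D -> a <= d -> x <= b -> regular f ->
  prim D f x = prim (D `\ d) f x + (if d < x then atom D d * f d else 0).
Proof.
move=> mD ad xb rf; have mDd : measurable (D `\ d) by apply: measurableD.
case: ltP => dx; last by rewrite addr0 /prim (cell_remove_out D a dx).
have mc := icell_measurable a x mDd.
have ma := atom_measurable d mD.
rewrite /prim (cell_remove D ad dx) Rintegral_setU//; last first.
- by apply/disj_setPS => t [[_ [_ /= td]] [/=]].
- rewrite -(cell_remove D ad dx); exact: cell_integrable.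
congr (_ + _); rewrite (@eq_Rintegral _ _ _ mu _ (fun=> f d)).
  by rewrite Rintegral_cst// mulrC.
by move=> t; rewrite inE => -[/= -> _].
Qed.

(** * Intermediate values in the absence of atoms *)

Section AtomFree.
Variable D : set R.
Hypothesis mD : measurable D.
Hypothesis no_atom : forall x, a <= x < b -> atom D x = 0.
Local Notation G := (gfun D).

(** The point is the supremum of the set [G <= t]. Small mass on its left excludes a value above
    [t]; small mass on its right, with no atom at the point itself, excludes a value below. *)
Lemma gfun_onto t : 0 <= t <= G b -> exists2 x, a <= x <= b & G x = t.
Proof.
move=> /andP[t0 tG].
pose S := [set y | a <= y <= b /\ G y <= t].
have Sa : S a by rewrite /S /= lexx le_ab gfun_at_a.
have Sb : ubound S b by move=> y [/andP[]].
have hS : has_sup S by split; [exists a|exists b].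
have as_ : a <= sup S by apply: sup_upper_bound.
have sb : sup S <= b by apply: ge_sup => //; exists a.
exists (sup S); first by rewrite as_.
apply/eqP; rewrite eq_le; apply/andP; split; rewrite leNgt; apply/negP => h.
  have as' : a < sup S.
    rewrite lt_neqAle as_ andbT; apply/eqP => e.
    by move: h; rewrite -e gfun_at_a ltNge t0.
  have e0 : 0 < G (sup S) - t by rewrite subr_gt0.
  have [y /andP[ay ys] my] := mass_left_small mD as' sb e0.
  have [|z [/andP[az zb] Gz] yz] := sup_adherent (E := S) (eps := sup S - y) _ hS.
    by rewrite subr_gt0.
  rewrite opprB addrC subrK in yz.
  have := gfun_nd mD ay (ltW yz) zb.
  have := gfun_split mD ay (ltW ys) sb; lra.
have sb' : sup S < b.
  rewrite lt_neqAle sb andbT; apply/eqP => e.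
  by move: h; rewrite e ltNge tG.
have e0 : 0 < t - G (sup S) by rewrite subr_gt0.
have [y /andP[sy yb] my] := mass_right_small mD as_ sb' e0.
have : y <= sup S.
  apply: sup_upper_bound => //; split; first by rewrite yb (le_trans as_ (ltW sy)).
  have := gfun_split mD as_ (ltW sy) yb.
  have := mass_remove mD as_ (lexx _) sy yb.
  rewrite (no_atom (x := sup S)) ?as_//; lra.
by rewrite leNgt sy.
Qed.

End AtomFree.

(** * Without atoms, iterated integration produces powers of [G] *)

Section BaseCase.
Variable D : set R.
Hypothesis mD : measurable D.
Hypothesis no_atom : forall x, a <= x < b -> atom D x = 0.
Local Notation G := (gfun D).

Lemma gfun_regular : regular G.
Proof.
split; first exact: gfun_measurable.
exists (G b) => x /andP[ax xb].
by rewrite ger0_norm ?gfun_ge0// gfun_nd.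
Qed.

Lemma regularX f n : regular f -> regular (fun x => f x ^+ n).
Proof.
move=> rf; elim: n => [|n IH]; first exact: regular_cst.
by apply: eq_regular (regularM rf IH) => x _; rewrite exprS.
Qed.

Lemma prim_cst c x : prim D (fun=> c) x = c * G x.
Proof. by rewrite /prim Rintegral_cst//; exact: icell_measurable. Qed.

(* [H := (n + 1) T (G ^ n) - G ^ (n + 1)] satisfies [|H z - H y| <= C (G z - G y) ^ 2]; since [G] takes all the values [i G(x) / N], summing [N] such bounds gives [|H x| <= C G(x) ^ 2 / N]. *)
Lemma prim_gfunX n x : a <= x <= b ->
  n.+1%:R * prim D (fun t => G t ^+ n) x = G x ^+ n.+1.
Proof.
have G0 := gfun_ge0 D.
have GB y : a <= y <= b -> 0 <= G y <= G b.
  by move=> /andP[ay yb]; rewrite G0 gfun_nd.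
have [C1 C10 HC1] := pow_lip n (G0 b).
have [C2 C20 HC2] := pow_taylor1 n (G0 b).
pose C := n.+1%:R * C1 + C2.
have C0 : 0 <= C by rewrite addr_ge0// mulr_ge0.
pose H y := n.+1%:R * prim D (fun t => G t ^+ n) y - G y ^+ n.+1.
have rX : regular (fun t => G t ^+ n) by apply: regularX; exact: gfun_regular.
have main y z : a <= y -> y <= z -> z <= b -> `|H z - H y| <= C * (G z - G y) ^+ 2.
  move=> ay yz zb.
  have yab : a <= y <= b by rewrite ay (le_trans yz).
  have zab : a <= z <= b by rewrite zb (le_trans ay).
  (* Freezing the integrand at [y] leaves a function of size at most [C1 (G z - G y)] on the cell,
     hence an integral of second order. *)
  pose f t := G t ^+ n + (- G y ^+ n).
  have rf : regular f by apply: regularD => //; exact: regular_cst.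
  have Tf u : u <= b -> prim D f u = prim D (fun t => G t ^+ n) u - G y ^+ n * G u.
    move=> ub; rewrite primD ?prim_cst ?mulNr//; exact: regular_cst.
  have -> : H z - H y = n.+1%:R * (prim D f z - prim D f y) -
     (G z ^+ n.+1 - G y ^+ n.+1 - n.+1%:R * G y ^+ n * (G z - G y)).
    by rewrite /H !Tf//; [ring|case/andP: yab].
  have Gyz : 0 <= G z - G y by rewrite subr_ge0 gfun_nd.
  have : `|prim D f z - prim D f y| <= C1 * (G z - G y) * (G z - G y).
    rewrite (prim_split mD ay yz zb rf) addrAC subrr add0r.
    rewrite {2}(gfun_split mD ay yz zb) [G y + _]addrC addrK.
    apply: le_cell_norm => // t /andP[yt tz].
    have tb := ltW (lt_le_trans tz zb); have ta := le_trans ay yt.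
    apply: le_trans (HC1 _ _ (GB _ _) (GB _ _)) _ => //; first by rewrite ta.
    rewrite ler_wpM2l// ger0_norm ?subr_ge0 ?gfun_nd// lerD2r gfun_nd//.
    exact: ltW.
  have := HC2 _ _ (GB _ zab) (GB _ yab).
  move=> h2 h1; apply: le_trans (ler_normB _ _) _.
  rewrite mulrDl lerD// normrM ger0_norm// -mulrA ler_wpM2l//.
  by rewrite expr2 mulrA.
have main' y z : a <= y <= b -> a <= z <= b -> `|H z - H y| <= C * (G z - G y) ^+ 2.
  move=> /andP[ay yb] /andP[az zb]; case: (leP y z) => [yz|/ltW zy]; first exact: main.
  rewrite distrC (_ : (G z - G y) ^+ 2 = (G y - G z) ^+ 2); first exact: main.
  by ring.
move=> xab.
have Ha : H a = 0 by rewrite /H prim_at_a gfun_at_a mulr0 expr0n subrr.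
have step N i y : (i <= N.+1)%N -> a <= y <= b -> G y = i%:R * (G x / N.+1%:R) ->
    `|H y| <= i%:R * (C * (G x / N.+1%:R) ^+ 2).
  elim: i y => [|i IH] y iN yab Gy.
    have := main' a y; rewrite lexx le_ab Ha gfun_at_a subr0 Gy mul0r => /(_ isT yab).
    by rewrite subr0 expr0n mulr0 mul0r.
  have [z zab Gz] : exists2 z, a <= z <= b & G z = i%:R * (G x / N.+1%:R).
    apply: gfun_onto => //; rewrite mulr_ge0 ?divr_ge0//=.
    apply: le_trans (_ : N.+1%:R * (G x / N.+1%:R) <= _).
      by rewrite ler_wpM2r ?divr_ge0// ler_nat ltnW.
    by rewrite mulrC divfK ?pnatr_eq0//; case/andP: (GB _ xab).
  have h1 := IH _ (ltnW iN) zab Gz.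
  have := main' _ _ zab yab.
  rewrite Gy Gz (_ : i.+1%:R * (G x / N.+1%:R) - _ = G x / N.+1%:R); last first.
    by rewrite -(natr1 i); ring.
  rewrite -(natr1 i).
  have := ler_normD (H y - H z) (H z); rewrite subrK.
  move: h1; set q := C * _ ^+ 2 => h1 h2 h3.
  by rewrite (_ : (i%:R + 1) * q = i%:R * q + q); [lra|ring].
apply/eqP; rewrite -subr_eq0 -/(H x); apply/eqP.
apply/eqP; rewrite -normr_le0 leNgt; apply/negP => Hx.
(* With this [N], the bound [C G(x)^2 / (N + 1)] falls below [|H x|]. *)
pose N := Num.truncn (C * G x ^+ 2 / `|H x|).
have : `|H x| <= N.+1%:R * (C * (G x / N.+1%:R) ^+ 2).
  by apply: step => //; rewrite mulrC divfK ?pnatr_eq0.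
rewrite (_ : _ * (C * _) = C * G x ^+ 2 / N.+1%:R); last first.
  have : N.+1%:R != 0 :> R by rewrite pnatr_eq0.
  by move: (N.+1%:R : R) => M M0; field.
rewrite ler_pdivlMr// mulrC -ler_pdivlMr// leNgt => /negP; apply.
have /truncn_itv/andP[_ //] : 0 <= C * G x ^+ 2 / `|H x|.
by rewrite divr_ge0// mulr_ge0// sqr_ge0.
Qed.

End BaseCase.

(** * Abstract g-polynomials and their uniform closure *)

Section GPolynomials.

(** The span of the iterates [T^n 1], presented inductively so that operator identities can be
    checked constructor by constructor; [gpoly_ext] disregards values outside [[a, b]]. *)
Inductive gpoly D : (R -> R) -> Prop :=
| gpoly_one : gpoly D (fun=> 1)
| gpolyD p q : gpoly D p -> gpoly D q -> gpoly D (fun x => p x + q x)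
| gpolyZ c p : gpoly D p -> gpoly D (fun x => c * p x)
| gpoly_prim p : gpoly D p -> gpoly D (prim D p)
| gpoly_ext p q : (forall x, a <= x <= b -> p x = q x) -> gpoly D p -> gpoly D q.

Definition gclosure D f := forall e, 0 < e ->
  exists2 p, gpoly D p & forall x, a <= x <= b -> `|f x - p x| <= e.

(** On the full domain, this is the g-monomial centred at [a] divided by [n!], on [[a, b]]. *)
Definition titer D n : R -> R := iter n (prim D) (fun=> 1).

Lemma gpoly_gclosure D p : gpoly D p -> gclosure D p.
Proof. by move=> gp e e0; exists p => // x _; rewrite subrr normr0 ltW. Qed.

Lemma gpoly_sum D (F : nat -> R -> R) n : (forall i, gpoly D (F i)) ->
  gpoly D (fun x => \sum_(i < n) F i x).
Proof.
move=> gF; elim: n => [|n IH].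
  apply: gpoly_ext (gpolyZ 0 (gpoly_one D)) => x _.
  by rewrite big_ord0 mul0r.
by apply: gpoly_ext (gpolyD IH (gF n)) => x _; rewrite big_ord_recr.
Qed.

Lemma gpoly_regular D p : measurable D -> gpoly D p -> regular p.
Proof.
move=> mD; elim=> {p} [|p q _ rp _ rq|c p _ rp|p _ rp|p q pq _ rp].
- exact: regular_cst.
- exact: regularD.
- by apply: regularM => //; exact: regular_cst.
- exact: prim_regular.
- exact: eq_regular rp.
Qed.

Lemma gclosure_lim D f : (forall e, 0 < e ->
    exists2 h, gclosure D h & forall x, a <= x <= b -> `|f x - h x| <= e) ->
  gclosure D f.
Proof.
move=> H e e0; have e20 : 0 < e / 2 by rewrite divr_gt0.
have [h gh fh] := H _ e20; have [p gp hp] := gh _ e20.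
exists p => // x xab; have := ler_normD (f x - h x) (h x - p x).
rewrite addrA subrK; have := fh _ xab; have := hp _ xab; lra.
Qed.

Lemma gclosure_ext D f h : (forall x, a <= x <= b -> f x = h x) ->
  gclosure D f -> gclosure D h.
Proof.
move=> fh gf e /gf[p gp fp]; exists p => // x xab.
by rewrite -fh// fp.
Qed.

Lemma gclosureD D f h : gclosure D f -> gclosure D h ->
  gclosure D (fun x => f x + h x).
Proof.
move=> gf gh e e0; have e20 : 0 < e / 2 by rewrite divr_gt0.
have [p gp fp] := gf _ e20; have [q gq hq] := gh _ e20.
exists (fun x => p x + q x); first exact: gpolyD.
move=> x xab; rewrite (_ : _ - _ = (f x - p x) + (h x - q x)); last by ring.
apply: le_trans (ler_normD _ _) _; have := fp _ xab; have := hq _ xab; lra.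
Qed.

Lemma gclosureZ D c f : gclosure D f -> gclosure D (fun x => c * f x).
Proof.
move=> gf e e0; have c0 : 0 < `|c| + 1 by rewrite ltr_wpDl.
have [p gp fp] := gf _ (divr_gt0 e0 c0).
exists (fun x => c * p x); first exact: gpolyZ.
move=> x xab; rewrite -mulrBr normrM.
have := fp _ xab; rewrite ler_pdivlMr//; apply: le_trans.
by rewrite mulrC ler_wpM2l// lerDl.
Qed.

(** Integration preserves g-polynomials and is bounded by [gfun D b] in the supremum norm; adding 1
    to that constant avoids a division by zero. *)
Lemma gclosure_prim D f : measurable D -> regular f -> gclosure D f ->
  gclosure D (prim D f).
Proof.
move=> mD rf gf e e0; have c0 : 0 < gfun D b + 1 by rewrite ltr_wpDl// gfun_ge0.
have [p gp fp] := gf _ (divr_gt0 e0 c0).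
have rp := gpoly_regular mD gp.
exists (prim D p); first exact: gpoly_prim.
move=> x xab; have xb : x <= b by case/andP: xab.
have rp' : regular (fun t => -1 * p t) by apply: regularM => //; exact: regular_cst.
have -> : prim D f x - prim D p x = prim D (fun t => f t + -1 * p t) x.
  by rewrite primD// primZ// mulN1r.
apply: le_trans (prim_norm_le mD xab (regularD rf rp') (M := e / (gfun D b + 1)) _) _.
  by move=> t tab; rewrite mulN1r; exact: fp.
rewrite -mulrA ler_piMr ?(ltW e0)// mulrC ler_pdivrMr// mul1r lerDl//.
Qed.

Lemma titer_ge0 D n x : 0 <= titer D n x.
Proof.
elim: n x => [|n IH] x; first exact: ler01.
by apply: Rintegral_ge0 => t _; exact: IH.
Qed.

Lemma titer_gpoly D n : gpoly D (titer D n).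
Proof. by elim: n => [|n IH]; [exact: gpoly_one|exact: gpoly_prim]. Qed.

Definition titer_decay D := forall l, 0 < l ->
  exists B, forall n x, a <= x <= b -> l ^+ n * titer D n x <= B.

End GPolynomials.

(** * Density and decay without atoms *)

Section BaseCaseDensity.
Variable D : set R.
Hypothesis mD : measurable D.
Hypothesis no_atom : forall x, a <= x < b -> atom D x = 0.
Local Notation G := (gfun D).

Lemma gfunX_gpoly n : gpoly D (fun x => G x ^+ n).
Proof.
elim: n => [|n IH]; first exact: gpoly_one.
apply: gpoly_ext (gpolyZ n.+1%:R (gpoly_prim IH)) => x xab.
exact: prim_gfunX.
Qed.

Lemma titer_gfunX n x : a <= x <= b -> titer D n x = n`!%:R^-1 * G x ^+ n.
Proof.
elim: n x => [|n IH] x xab; first by rewrite fact0 invr1 mul1r.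
have xb : x <= b by case/andP: xab.
rewrite /titer iterS (eq_prim D xb (h := fun t => n`!%:R^-1 * G t ^+ n)) => [|t tab].
  rewrite primZ//; last by apply: regularX; exact: gfun_regular.
  rewrite -prim_gfunX// factS natrM.
  have : n`!%:R != 0 :> R by rewrite pnatr_eq0 -lt0n fact_gt0.
  have : n.+1%:R != 0 :> R by rewrite pnatr_eq0.
  by move: (n.+1%:R : R) (n`!%:R : R) => u v u0 v0; field; rewrite v0.
exact: (IH t tab).
Qed.

(** The quantity is at most [(l G(b))^n / n!], a term of the exponential series, and these terms are
    bounded. *)
Lemma titer_decay_base : titer_decay D.
Proof.
move=> l l0.
have [M [_ HM]] := cvg_seq_bounded (cvgP _ (cvg_exp_coeff (l * G b))).
exists (M + 1) => n x xab; rewrite titer_gfunX//.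
have := HM (M + 1); rewrite ltrDl => /(_ ltr01 n I); apply: le_trans.
rewrite exp_coeffE /= ger0_norm; last first.
  by rewrite mulr_ge0 ?invr_ge0// exprn_ge0// mulr_ge0 ?(ltW l0) ?gfun_ge0.
rewrite exprMn mulrCA ler_wpM2l ?invr_ge0// ler_wpM2l ?exprn_ge0 ?(ltW l0)//.
by rewrite lerXn2r ?nnegrE ?gfun_ge0//; case/andP: xab => *; exact: gfun_nd.
Qed.

Lemma poly_gfun_gpoly (q : {poly R}) c : gpoly D (fun x => q.[G x / c]).
Proof.
apply: gpoly_ext (gpoly_sum (size q) (F := fun i x => (q`_i * c^-1 ^+ i) * G x ^+ i) _).
  move=> x _; rewrite horner_coef; apply: eq_bigr => i _.
  by rewrite exprMn -mulrA [c^-1 ^+ _ * _]mulrC.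
by move=> i; apply: gpolyZ; exact: gfunX_gpoly.
Qed.

(** Bernstein's proof of Weierstrass' theorem, transported by [G]: [f] is sampled at points where
    [G] takes the values [k G(b) / n]. *)
Lemma gclosure_base f : ucont D f -> gclosure D f.
Proof.
move=> uf e e0; have [B fB] := ucont_bounded mD uf.
have B0 : 0 <= B by apply: le_trans (fB a _); rewrite ?lexx.
have e20 : 0 < e / 2 by rewrite divr_gt0.
have [d d0 fd] := uf _ e20.
pose M := G b; have M0 : 0 <= M := gfun_ge0 D b.
(* When [G x] and [G (y k)] are at least [d] apart, [2 B] is at most [2 B / d^2] times their squared
   distance, which is [K / n^2 (k - n t)^2]. *)
pose K := 2 * B * M ^+ 2 / d ^+ 2.
have d20 : 0 < d ^+ 2 by rewrite exprn_gt0.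
have K0 : 0 <= K by rewrite divr_ge0 ?(ltW d20)// mulr_ge0 ?sqr_ge0// mulr_ge0.
pose n := (Num.truncn (K / (e / 2))).+1.
have n0 : 0 < n%:R :> R by rewrite ltr0n.
have Kn : K / n%:R <= e / 2.
  rewrite ler_pdivrMr// mulrC -ler_pdivrMr//; apply: ltW.
  have /truncn_itv/andP[_ //] : 0 <= K / (e / 2).
  by rewrite divr_ge0// ltW.
have Hy k : (k <= n)%N -> exists y, a <= y <= b /\ G y = M / n%:R * k%:R.
  move=> kn; have [y yab Gy] : exists2 y, a <= y <= b & G y = M / n%:R * k%:R.
    apply: gfun_onto => //; rewrite mulr_ge0 ?divr_ge0//=.
    by rewrite mulrAC ler_pdivrMr// ler_wpM2l// ler_nat.
  by exists y.
pose y k := xget a [set y | a <= y <= b /\ G y = M / n%:R * k%:R].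
have yP k : (k <= n)%N -> a <= y k <= b /\ G (y k) = M / n%:R * k%:R.
  move=> /Hy[z zP]; rewrite /y; case: xgetP => [w -> //|/(_ z)].
  by move=> /(_ zP).
exists (fun x => (bernstein n (f \o y)).[G x / M]); first exact: poly_gfun_gpoly.
move=> x xab.
have Gx0 : 0 <= G x by exact: gfun_ge0.
have GxM : G x <= M by case/andP: xab => *; exact: gfun_nd.
have GM : G x = M * (G x / M).
  (* If [M = 0] then [G x = 0] as well, and the identity survives division by zero. *)
  have [M00|M00] := eqVneq M 0; last by rewrite mulrC divfK.
  by rewrite M00 mul0r; apply/eqP; rewrite eq_le Gx0 andbT -M00.
set t := G x / M in GM *.
have t01 : 0 <= t <= 1.
  rewrite /t divr_ge0//=; move: M0; rewrite le_eqVlt => /orP[/eqP<-|M0].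
    by rewrite invr0 mulr0.
  by rewrite ler_pdivrMr// mul1r.
apply: le_trans (bernstein_approx (v := f x) (e := e / 2) (A := K / n%:R ^+ 2) t01 _) _.
  move=> k /yP[yab Gy] /=.
  have [Gd|Gd] := ltP `|G x - G (y k)| d.
    apply: le_trans (ltW (fd _ _ xab yab Gd)) _.
    by rewrite lerDl mulr_ge0 ?sqr_ge0// divr_ge0// sqr_ge0.
  apply: le_trans (_ : 2 * B <= _).
    apply: le_trans (ler_normB _ _) _; have := fB _ xab; have := fB _ yab; lra.
  apply: le_trans (_ : 2 * B / d ^+ 2 * (G x - G (y k)) ^+ 2 <= _).
    rewrite mulrAC ler_pdivlMr// ler_wpM2l ?mulr_ge0//.
    by rewrite -[leRHS]real_normK ?num_real// lerXn2r ?nnegrE// ltW.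
  rewrite GM Gy (_ : _ * (_ - _) ^+ 2 = K / n%:R ^+ 2 * (k%:R - n%:R * t) ^+ 2).
    by rewrite lerDr ltW.
  rewrite /K; move: n0; move: (n%:R : R) (k%:R : R) => n' k' n0.
  by field; rewrite !gt_eqF.
have tt : t * (1 - t) <= 1 by move: t01 => /andP[]; nra.
rewrite [leRHS]splitr lerD2l; apply: le_trans Kn.
rewrite (_ : _ * (n%:R * t * (1 - t)) = K / n%:R * (t * (1 - t))).
  by rewrite ler_piMr// divr_ge0// ltW.
move: n0; move: (n%:R : R) => n' n0; field; exact: lt0r_neq0.
Qed.

End BaseCaseDensity.

(** * Inverting [T + c] inside the closure *)

Lemma neumann_gclosure D (c : R) W : measurable D -> 0 < c -> titer_decay D ->
  regular W -> gclosure D (fun x => prim D W x + c * W x) -> gclosure D W.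
Proof.
move=> mD c0 dec rW gv; have [_ [M WM]] := rW.
have M0 : 0 <= M by apply: le_trans (WM a _); rewrite ?lexx.
pose V n := iter n (prim D) W.
have rV n : regular (V n) by elim: n => [//|n IH]; exact: prim_regular.
have rt n : regular (titer D n) by apply: gpoly_regular mD (titer_gpoly D n).
have rMt (N : R) n : regular (fun t => N * titer D n t).
  by apply: regularM => //; exact: regular_cst.
have VM n x : a <= x <= b -> `|V n x| <= M * titer D n x.
  elim: n x => [|n IH] x xab; first by rewrite /titer/= mulr1 WM.
  have xb : x <= b by case/andP: xab.
  rewrite ler_norml -mulNr [V _]iterS [titer _ _]iterS.
  rewrite -(primZ mD (- M) xb (rt n)) -(primZ mD M xb (rt n)); apply/andP; split.
    apply: (le_prim mD xb (rMt _ n) (rV n)) => t /IH; rewrite ler_norml => /andP[+ _].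
    by rewrite mulNr.
  apply: (le_prim mD xb (rV n) (rMt _ n)) => t /IH.
  by rewrite ler_norml => /andP[_].
pose r := - c^-1.
(* Applying [T] repeatedly to the hypothesis keeps it in the closure; suitable multiples of these
   functions telescope to [W - r^n T^n W]. *)
have gVn n : gclosure D (fun x => V n.+1 x + c * V n x).
  elim: n => [//|n IH].
  have rcV : regular (fun x => c * V n x) by apply: regularM => //; exact: regular_cst.
  have := gclosure_prim mD (regularD (rV n.+1) rcV) IH.
  apply: gclosure_ext => x /andP[_ xb].
  by rewrite primD// primZ.
have gS n : gclosure D (fun x => W x - r ^+ n * V n x).
  elim: n => [|n IH].
    apply: gclosure_ext (gpoly_gclosure (gpolyZ 0 (gpoly_one D))) => x _.
    by rewrite mul0r expr0 mul1r subrr.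
  apply: gclosure_ext (gclosureD IH (gclosureZ (r ^+ n / c) (gVn n))) => x _.
  rewrite exprS /r; field; exact: lt0r_neq0.
(* The rate [2 / c] absorbs the factor [c^-n] and leaves [2^-n] for the remainder. *)
have [B HB] := dec (2 / c) (divr_gt0 (ltr0Sn _ 1) c0).
apply: gclosure_lim => e e0.
pose n := (Num.truncn (M * B / e)).+1.
exists (fun x => W x - r ^+ n * V n x) => // x xab.
have rn : `|r| = c^-1 by rewrite normrN gtr0_norm ?invr_gt0.
rewrite opprB addrC subrK normrM normrX rn.
apply: le_trans (_ : c^-1 ^+ n * (M * titer D n x) <= _).
  by rewrite ler_wpM2l ?VM// exprn_ge0// invr_ge0 ltW.
have B0 : 0 <= B by apply: le_trans (HB n x xab); rewrite mulr_ge0 ?titer_ge0// exprn_ge0// divr_ge0// ltW.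
apply: le_trans (_ : M * B / 2 ^+ n <= _).
  rewrite ler_pdivlMr ?exprn_gt0//.
  rewrite (_ : _ * 2 ^+ n = M * ((2 / c) ^+ n * titer D n x)).
    by rewrite ler_wpM2l// HB.
  by rewrite exprMn; ring.
rewrite ler_pdivrMr ?exprn_gt0// [e * _]mulrC -ler_pdivrMr//.
have /truncn_itv/andP[_ h] : 0 <= M * B / e by rewrite divr_ge0 ?mulr_ge0// ltW.
apply: le_trans (ltW h) _; rewrite -/n -natrX ler_nat ltnW//.
exact: ltn_expl.
Qed.

(** * Algebra of uniformly g-continuous functions *)

Lemma ucont_cst D c : ucont D (fun=> c).
Proof. by move=> e e0; exists 1 => // x y _ _ _; rewrite subrr normr0. Qed.

Lemma ucontD D f h : ucont D f -> ucont D h -> ucont D (fun x => f x + h x).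
Proof.
move=> uf uh e e0; have e20 : 0 < e / 2 by rewrite divr_gt0.
have [d1 d10 H1] := uf _ e20; have [d2 d20 H2] := uh _ e20.
exists (Num.min d1 d2) => [|x y xab yab]; first by rewrite lt_min d10.
rewrite lt_min => /andP[/(H1 _ _ xab yab) h1 /(H2 _ _ xab yab) h2].
rewrite opprD addrACA; apply: le_lt_trans (ler_normD _ _) _; move: h1 h2; lra.
Qed.

Lemma ucontM D f h : measurable D -> ucont D f -> ucont D h ->
  ucont D (fun x => f x * h x).
Proof.
move=> mD uf uh e e0.
have [M fM] := ucont_bounded mD uf; have [N hN] := ucont_bounded mD uh.
have M0 : 0 <= M by apply: le_trans (fM a _); rewrite ?lexx.
have N0 : 0 <= N by apply: le_trans (hN a _); rewrite ?lexx.
have K0 : 0 < M + N + 1 by rewrite ltr_wpDl// addr_ge0.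
have eK : 0 < e / (M + N + 1) by rewrite divr_gt0.
have [d1 d10 H1] := uf _ eK; have [d2 d20 H2] := uh _ eK.
exists (Num.min d1 d2) => [|x y xab yab]; first by rewrite lt_min d10.
rewrite lt_min => /andP[/(H1 _ _ xab yab) h1 /(H2 _ _ xab yab) h2].
rewrite (_ : _ - _ = f x * (h x - h y) + (f x - f y) * h y); last by ring.
apply: le_lt_trans (ler_normD _ _) _; rewrite !normrM.
apply: le_lt_trans (_ : (M + N) * (e / (M + N + 1)) < _).
  rewrite mulrDl lerD//; first by rewrite ler_pM ?fM// ltW.
  by rewrite mulrC ler_pM ?hN// ltW.
by rewrite mulrCA gtr_pMr// ltr_pdivrMr// mul1r ltrDl.
Qed.

Lemma eq_ucont D f h : (forall x, a <= x <= b -> f x = h x) -> ucont D f -> ucont D h.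
Proof.
move=> fh uf e /uf[d d0 H]; exists d => // x y xab yab.
by rewrite -!fh//; exact: H.
Qed.

Lemma gpoly_ucont D p : measurable D -> gpoly D p -> ucont D p.
Proof.
move=> mD; elim=> {p} [|p q _ rp _ rq|c p _ rp|p gp _|p q pq _ rp].
- exact: ucont_cst.
- exact: ucontD.
- by apply: ucontM => //; exact: ucont_cst.
- by apply: prim_ucont => //; exact: gpoly_regular gp.
- exact: eq_ucont rp.
Qed.

(* A function that vanishes where [G d - G t >= e] lives on a left neighbourhood of [d] whose mass is controlled by [e]. *)
Lemma le_prim_near D d f B e x : measurable D -> a <= d -> d <= b -> x <= d -> a <= x ->
  0 <= B -> 0 < e -> regular f ->
  (forall t, a <= t < d -> `|f t| <= B) ->
  (forall t, a <= t < d -> e <= gfun D d - gfun D t -> f t = 0) ->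
  `|prim D f x| <= 2 * B * e.
Proof.
move=> mD ad db xd ax B0 e0 rf fB f0; have xb := le_trans xd db.
have Be0 : 0 <= B * e by rewrite mulr_ge0// ltW.
(* [f] vanishes on [[a, d)] outside [S], hence before [inf S], which need not belong to [S]. *)
pose S := [set y | a <= y <= d /\ gfun D d - gfun D y < e].
have Sd : S d by rewrite /S/= ad lexx subrr.
have Sl : lbound S a by move=> y [/andP[]].
have hS : has_inf S by split; [exists d|exists a].
pose x1 := inf S.
have ax1 : a <= x1 by apply: lb_le_inf => //; exists d.
have Sout t : a <= t < d -> ~ S t -> f t = 0.
  move=> tad St; apply: f0 => //; rewrite leNgt; apply/negP => h.
  by apply: St; split => //; case/andP: tad => -> /ltW.
have T0 y : a <= y -> y <= x1 -> y <= d -> prim D f y = 0.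
  move=> ay yx1 yd; apply/eqP; rewrite -normr_le0.
  rewrite -[leRHS](mul0r (mass D a y)); apply: le_cell_norm => //.
    exact: le_trans yd db.
  move=> t /andP[at_ ty]; rewrite Sout ?normr0//; first by rewrite at_ (lt_le_trans ty).
  move=> St; have : x1 <= t by apply: inf_lbound => //; exists a.
  by rewrite leNgt (lt_le_trans ty).
have [xx1|x1x] := leP x x1.
  by rewrite T0// normr0 -mulrA mulr_ge0.
have x1d := lt_le_trans x1x xd.
have fin y : a <= y -> S y -> y <= x ->
    `|prim D f x - prim D f y| <= B * e.
  move=> ay [/andP[_ yd] Sy] yx.
  rewrite (prim_split mD ay yx xb rf) addrAC subrr add0r.
  apply: le_trans (_ : B * mass D y x <= _).
    apply: le_cell_norm => // t /andP[yt tx]; apply: fB.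
    by rewrite (le_trans ay yt) (lt_le_trans tx xd).
  rewrite ler_wpM2l//; have := gfun_split mD ay yx xb.
  have := gfun_nd mD ax xd db; lra.
have [/eqP fx1|fx1] := boolP (f x1 == 0); last first.
  have Sx1 : S x1.
    apply: contrapT => /Sout; rewrite ax1 x1d => /(_ isT) h.
    by rewrite h eqxx in fx1.
  have := fin _ ax1 Sx1 (ltW x1x); rewrite (T0 x1 ax1 (lexx _) (ltW x1d)) subr0.
  lra.
(* Here [f x1 = 0], so an atom at [x1] contributes nothing. A point [z] of [S] close to [x1] splits
   the integral into two pieces, each at most [B e]. *)
have [y /andP[x1y yb] my] := mass_right_small mD ax1 (lt_le_trans x1d db) e0.
have [|z Sz zy] := inf_adherent (E := S) (eps := Num.min y x - x1) _ hS.
  by rewrite subr_gt0 lt_min x1y.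
rewrite -/x1 addrC subrK lt_min in zy; move: zy => /andP[zy zx].
have x1z : x1 <= z by apply: inf_lbound => //; exists a.
have az := le_trans ax1 x1z.
have zb := le_trans (ltW zx) xb.
have h1 := fin _ az Sz (ltW zx).
have mDx : measurable (D `\ x1) by apply: measurableD.
have h2 : `|prim D f z| <= B * e.
  have -> : prim D f z = prim (D `\ x1) f z - prim (D `\ x1) f x1.
    rewrite (prim_remove mD ax1 zb rf) fx1 mulr0 if_same addr0.
    have := prim_remove mD ax1 (ltW (lt_le_trans x1d db)) rf.
    by rewrite ltxx addr0 (T0 x1 ax1 (lexx _) (ltW x1d)) => <-; rewrite subr0.
  rewrite (prim_split mDx ax1 x1z zb rf) addrAC subrr add0r.
  apply: le_trans (_ : B * mass (D `\ x1) x1 z <= _).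
    apply: le_cell_norm => // t /andP[yt tx]; apply: fB.
    by rewrite (le_trans ax1 yt) (lt_le_trans tx)// (le_trans (ltW zx) xd).
  rewrite ler_wpM2l//.
  have := gfun_split mDx ax1 x1z zb.
  have := gfun_split mDx ax1 (ltW x1y) yb.
  have := gfun_nd mDx az (ltW zy) yb; lra.
have := ler_normD (prim D f x - prim D f z) (prim D f z); rewrite subrK.
move: h1 h2; lra.
Qed.

(** * Inductive step: restoring the atom at [d] *)

Section RemoveAtom.
Variables (D : set R) (d : R).
Hypothesis mD : measurable D.
Hypothesis ad : a <= d.
Hypothesis db : d < b.
Let D' := D `\ d.
Let c := atom D d.
Hypothesis c0 : 0 < c.
Hypothesis dense' : forall f, ucont D' f -> gclosure D' f.
Hypothesis decay' : titer_decay D'.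

Let mD' : measurable D'. Proof. exact: measurableD. Qed.
Let chi (x : R) : R := if d < x then 1 else 0.
Let dab : a <= d <= b. Proof. by rewrite ad ltW. Qed.
Let inb x : a <= x <= b -> x <= b. Proof. by case/andP. Qed.
Local Notation T := (prim D).
Local Notation T' := (prim D').
Local Notation G := (gfun D).
Local Notation G' := (gfun D').

Let chid : chi d = 0. Proof. by rewrite /chi ltxx. Qed.

Let Tchi f x : a <= x <= b -> regular f -> T f x = T' f x + c * (chi x * f d).
Proof.
move=> /inb xb rf; rewrite (prim_remove mD ad xb rf) /chi.
by case: ifP; rewrite ?mul1r ?mul0r ?mulr0.
Qed.

Let Gchi x : a <= x <= b -> G x = G' x + c * chi x.
Proof.
by move=> /inb xb; rewrite (gfun_remove mD ad xb) /chi; case: ifP; rewrite ?mulr1 ?mulr0.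
Qed.

Let chi_reg : regular chi.
Proof.
apply: (@eq_regular (fun x => c^-1 * (G x + -1 * G' x))).
  by move=> x xab; rewrite Gchi// mulN1r addrAC subrr add0r mulKf ?gt_eqF.
apply: regularM; first exact: regular_cst.
apply: regularD; first exact: gfun_regular.
by apply: regularM; [exact: regular_cst|exact: gfun_regular].
Qed.

(* [L p(T') 1 = p(T) T 1] for every polynomial [p]. *)
Let L u x := T' u x + c * (chi x * u x).

(** [D'] omits [d], so on the cell from [d] to [x] the factor [chi] is 1 at every point that
    counts. *)
Let prim_chi u x : a <= x <= b -> regular u ->
  T' (fun t => chi t * u t) x = chi x * (T' u x - T' u d).
Proof.
move=> /andP[ax xb] ru; have rcu := regularM chi_reg ru.
have le_d y : y <= d -> T' (fun t => chi t * u t) y = 0.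
  move=> yd; rewrite /prim (@eq_Rintegral _ _ _ mu _ (fun=> 0)).
    by rewrite Rintegral_cst ?mul0r//; exact: icell_measurable.
  move=> t; rewrite inE => -[/=]; rewrite in_itv/= => /andP[_ ty] _.
  by rewrite /chi ltNge (ltW (lt_le_trans ty yd)) mul0r.
rewrite {2}/chi; case: ltP => dx; last by rewrite mul0r le_d.
rewrite mul1r (prim_split mD' ad (ltW dx) xb rcu) le_d// add0r.
rewrite (prim_split mD' ad (ltW dx) xb ru) addrAC subrr add0r.
apply: eq_Rintegral => t; rewrite inE => -[/=]; rewrite in_itv/= => /andP[dt _] [_ /= td].
rewrite /chi lt_neqAle dt andbT ifT ?mul1r// eq_sym; exact/eqP.
Qed.

Let L_regular u : regular u -> regular (L u).
Proof.
move=> ru; apply: regularD; first exact: prim_regular.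
apply: regularM; first exact: regular_cst.
exact: regularM.
Qed.

(** The boundary term [T' u d] from [prim_chi] cancels against the jump of [T], because [chi d = 0]
    gives [L u d = T' u d]. *)
Let L_prim u x : a <= x <= b -> regular u -> L (T' u) x = T (L u) x.
Proof.
move=> xab ru; have xb := inb xab; have rTu := prim_regular mD' ru.
have rcu := regularM chi_reg ru.
have rccu : regular (fun t => c * (chi t * u t)) by apply: regularM => //; exact: regular_cst.
rewrite Tchi//; last exact: L_regular.
rewrite /L chid mul0r mulr0 addr0 primD// primZ// prim_chi//.
ring.
Qed.

Let L_gpoly p : gpoly D' p -> gpoly D (L p).
Proof.
elim=> {p} [|p q gp Lp gq Lq|k p gp Lp|p gp Lp|p q pq gp Lp].
- apply: gpoly_ext (gpoly_prim (gpoly_one D)) => x xab.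
  by rewrite Tchi//; exact: regular_cst.
- apply: gpoly_ext (gpolyD Lp Lq) => x /inb xb.
  rewrite /L primD//; [ring|exact: gpoly_regular gp|exact: gpoly_regular gq].
- apply: gpoly_ext (gpolyZ k Lp) => x /inb xb.
  rewrite /L primZ//; [ring|exact: gpoly_regular gp].
- apply: gpoly_ext (gpoly_prim Lp) => x xab.
  rewrite L_prim//; exact: gpoly_regular gp.
- apply: gpoly_ext Lp => x xab.
  by rewrite /L pq// (eq_prim D' (inb xab) pq).
Qed.

Let L_gclosure u : ucont D' u -> gclosure D (L u).
Proof.
move=> uu e e0; have ru := ucont_regular mD' uu.
have K0 : 0 < G' b + c + 1 by rewrite ltr_wpDl// addr_ge0 ?gfun_ge0// ltW.
have eK : 0 < e / (G' b + c + 1) by rewrite divr_gt0.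
have [p gp up] := dense' uu eK.
have rp := gpoly_regular mD' gp.
have rNp : regular (fun t => -1 * p t) by apply: regularM => //; exact: regular_cst.
exists (L p); first exact: L_gpoly.
move=> x xab; have xb := inb xab.
rewrite (_ : _ - _ = T' (fun t => u t + -1 * p t) x + c * (chi x * (u x - p x))); last first.
  by rewrite primD// primZ// /L; ring.
apply: le_trans (ler_normD _ _) _.
apply: le_trans (_ : e / (G' b + c + 1) * G' b + c * (e / (G' b + c + 1)) <= _).
  rewrite lerD//.
    apply: prim_norm_le => //; first exact: regularD.
    by move=> t tab; rewrite mulN1r up.
  rewrite normrM gtr0_norm// ler_wpM2l ?(ltW c0)// normrM /chi.
  case: ifP => _; first by rewrite normr1 mul1r up.
  by rewrite normr0 mul0r ltW.
rewrite [c * _]mulrC -mulrDr mulrAC ler_pdivrMr// ler_wpM2l ?(ltW e0)//.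
by rewrite lerDl.
Qed.

Let titerL n x : a <= x <= b -> titer D n.+1 x = L (titer D' n) x.
Proof.
elim: n x => [|n IH] x xab.
  by rewrite /titer/= Tchi//; exact: regular_cst.
rewrite {1}/titer iterS (eq_prim D (inb xab) IH) -L_prim//.
exact: gpoly_regular (titer_gpoly D' n).
Qed.

Lemma titer_decay_remove : titer_decay D.
Proof.
move=> l l0; have [B HB] := decay' l0.
have B0 : 1 <= B by have := HB 0%N a; rewrite lexx le_ab expr0 mul1r => /(_ isT).
(* [T^(n+1) 1] is [T'^(n+1) 1] plus [c chi T'^n 1]; the second term has one factor [l] to spare. *)
exists (B + l * c * B) => -[|n] x xab.
  rewrite expr0 mul1r /titer/= (le_trans B0)// lerDl.
  rewrite mulr_ge0 ?mulr_ge0 ?(ltW c0) ?(ltW l0)//; lra.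
rewrite titerL// /L mulrDr lerD//; first exact: (HB n.+1 x xab).
rewrite exprS (_ : _ * _ = l * c * (chi x * (l ^+ n * titer D' n x))); last by ring.
rewrite ler_wpM2l ?mulr_ge0 ?(ltW c0) ?(ltW l0)// /chi.
case: ifP => _; first by rewrite mul1r HB.
by rewrite mul0r; lra.
Qed.

Let Gd x y : a <= x <= b -> a <= y <= b -> (d < x) = (d < y) -> G x - G y = G' x - G' y.
Proof. by move=> xab yab xy; rewrite !Gchi// /chi xy; ring. Qed.

(** Crossing [d] costs at least the jump [c]; below that scale, G-continuity treats the two sides of
    [d] independently. *)
Let Gjump x y : a <= x <= b -> a <= y <= b -> `|G x - G y| < c -> (d < x) = (d < y).
Proof.
wlog xy : x y / x <= y.
  move=> H xab yab h; case: (leP x y) => [|/ltW] xy; first exact: H.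
  by apply/esym/H => //; rewrite distrC.
move=> /andP[ax xb] /andP[ay yb] h.
case: (ltP d x) => dx; first by rewrite (lt_le_trans dx xy).
apply/esym/negbTE; rewrite -leNgt leNgt; apply/negP => dy; move: h.
rewrite ltNge => /negP; apply.
rewrite distrC !Gchi ?ax ?ay// /chi dy ltNge dx /= mulr1 mulr0 addr0.
apply: le_trans (ler_norm _); have := gfun_nd mD' ax xy yb; lra.
Qed.

(* [u] agrees with [W] on [[e, b]], equals the almost constant value [W e] on [[d, e]] and decreases to [0] steeply, but [G']-continuously, to the left of [d]; then [L u] is uniformly close to [T W + c W]. *)
Lemma gclosure_supp_right W : ucont D W -> (forall x, a <= x <= d -> W x = 0) ->
  gclosure D W.
Proof.
move=> uW W0; have rW := ucont_regular mD uW.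
apply: (neumann_gclosure mD c0 titer_decay_remove rW).
have [B WB] := ucont_bounded mD uW.
have B0 : 0 <= B by apply: le_trans (WB a _); rewrite ?lexx.
apply: gclosure_lim => e0 e00.
(* Error budget in units of [e1]: [2 B] for the ramp, [G' b] for the integral right of [d], [c] for
   the pointwise term, and 1 for positivity. *)
pose K := 2 * B + G' b + c + 1.
have G'b0 : 0 <= G' b by exact: gfun_ge0.
have K0 : 0 < K by rewrite /K; move: B0 c0 G'b0; lra.
pose e1 := e0 / K; have e10 : 0 < e1 by rewrite divr_gt0.
have [de de0 Wde] := uW _ e10.
(* Without its atom, the neighbourhood has mass below [de], so [W] differs from [W e] by at most
   [e1] on [(d, e]]. *)
have [e /andP[de_ eb] me] := mass_right_small mD ad db de0.
have ae := le_trans ad (ltW de_).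
have eab : a <= e <= b by rewrite ae.
(* Only points beyond [d] are visited, where [G] and [G'] differ by a constant; hence [W (mx x)] is
   G'-continuous. *)
pose mx x := Num.max x e.
have mxab x : a <= x <= b -> a <= mx x <= b.
  by move=> /andP[ax xb]; rewrite /mx le_max ax ge_max xb.
have mxd x : d < mx x by rewrite /mx lt_max de_ orbT.
have mxG x y : a <= x <= b -> a <= y <= b ->
    `|G (mx x) - G (mx y)| <= `|G' x - G' y|.
  wlog xy : x y / x <= y.
    move=> H xab yab; case: (leP x y) => [|/ltW] xy; first exact: H.
    by rewrite distrC [leRHS]distrC; exact: H.
  move=> xab yab; rewrite Gd ?mxab// ?mxd//.
  move: (xab) (yab) => /andP[ax xb] /andP[ay yb].
  have mxy : mx x <= mx y by rewrite /mx le_max2.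
  have axm : a <= mx x by case/andP: (mxab x xab).
  have ymb : mx y <= b by case/andP: (mxab y yab).
  rewrite distrC [leRHS]distrC !ger0_norm ?subr_ge0 ?gfun_nd//.
  rewrite /mx; case: (leP y e) => ye.
    by rewrite (max_idPr (le_trans xy ye)) subrr subr_ge0 gfun_nd.
  rewrite lerD2l lerN2 gfun_nd// ?le_max ?lexx//.
  by rewrite ge_max xb eb.
have Wnear x : d < x -> x <= b -> `|W (mx x) - W x| <= e1.
  move=> dx xb; have xab : a <= x <= b by rewrite xb (le_trans ad (ltW dx)).
  rewrite /mx; case: (leP x e) => xe; last by rewrite subrr normr0 ltW.
  apply/ltW/Wde => //; rewrite Gd//; last by rewrite de_ dx.
  have ax := le_trans ad (ltW dx).
  rewrite ger0_norm ?subr_ge0 ?gfun_nd//; apply: le_lt_trans me.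
  have := gfun_split mD' ad (ltW de_) eb.
  have := gfun_nd mD' ad (ltW dx) xb; rewrite -/D'; lra.
pose ramp x : R := Num.max 0 (Num.min 1 (1 + (G' x - G' d) / e1)).
have ramp0 x : 0 <= ramp x by rewrite /ramp le_max lexx.
have ramp1 x : ramp x <= 1 by rewrite /ramp ge_max ler01 ge_min lexx.
have rampR x : d <= x -> x <= b -> ramp x = 1.
  move=> dx xb; have h : 1 <= 1 + (G' x - G' d) / e1.
    by rewrite lerDl divr_ge0 ?(ltW e10)// subr_ge0 gfun_nd.
  by rewrite /ramp (min_idPl h) (max_idPr ler01).
have rampL x : e1 <= G' d - G' x -> ramp x = 0.
  move=> h; have h1 : 1 + (G' x - G' d) / e1 <= 0.
    by rewrite -lerBrDl sub0r ler_pdivrMr// mulN1r; move: h; lra.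
  by rewrite /ramp (min_idPr (le_trans h1 ler01)) (max_idPl h1).
have ramplip x y : `|ramp x - ramp y| <= `|G' x - G' y| / e1.
  apply: le_trans (clamp_lip _ _) _.
  rewrite opprD addrACA subrr add0r -mulrBl normrM normfV (gtr0_norm e10).
  by rewrite opprB addrA subrK.
have uramp : ucont D' ramp.
  move=> s s0; exists (s * e1); first by rewrite mulr_gt0.
  move=> x y _ _ h; apply: le_lt_trans (ramplip x y) _.
  by rewrite ltr_pdivrMr.
have uWm : ucont D' (fun x => W (mx x)).
  move=> s /uW[t t0 H]; exists t => // x y xab yab h.
  by apply: H; rewrite ?mxab//; apply: le_lt_trans h; exact: mxG.
pose u x := W (mx x) * ramp x.
have uu : ucont D' u by exact: ucontM.
have ru := ucont_regular mD' uu.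
have rNW : regular (fun t => -1 * W t) by apply: regularM => //; exact: regular_cst.
pose f t := u t + -1 * W t.
have rf : regular f by exact: regularD.
have fR t : d < t -> t <= b -> `|f t| <= e1.
  by move=> dt tb; rewrite /f /u rampR ?(ltW dt)// mulr1 mulN1r Wnear.
have fL t : a <= t < d -> f t = W e * ramp t.
  move=> /andP[at_ td]; rewrite /f W0 ?at_ ?ltW// mulr0 addr0 /u /mx.
  by rewrite (max_idPr (ltW (lt_trans td de_))).
exists (L u); first exact: L_gclosure.
move=> x xab; have xb := inb xab.
have ax : a <= x by case/andP: xab.
have near y : a <= y -> y <= d -> `|T' f y| <= 2 * B * e1.
  move=> ay yd; apply: (le_prim_near mD' ad (ltW db)) => //.
    move=> t tad; rewrite fL// normrM (ger0_norm (ramp0 _)).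
    by rewrite -[leRHS]mulr1 ler_pM ?WB.
  by move=> t tad h; rewrite fL// rampL ?mulr0.
have Tf : `|T' f x| <= 2 * B * e1 + e1 * G' b.
  have [xd|dx] := leP x d.
    by apply: le_trans (near _ ax xd) _; rewrite lerDl mulr_ge0// ltW.
  rewrite (prim_split mD' ad (ltW dx) xb rf); apply: le_trans (ler_normD _ _) _.
  apply: lerD; first exact: near.
  apply: le_trans (_ : e1 * mass D' d x <= _).
    apply: le_prim_norm => //; first exact: icell_measurable.
      exact: icell_sub.
    move=> t [/=]; rewrite in_itv/= => /andP[dt tx] [_ /= td].
    apply: fR; last exact: ltW (lt_le_trans tx xb).
    by rewrite lt_neqAle dt andbT eq_sym; exact/eqP.
  rewrite ler_wpM2l ?(ltW e10)//.
  have := gfun_split mD' ad (ltW dx) xb; have := gfun_nd mD' ax xb (lexx _).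
  have := gfun_ge0 D' d; lra.
have cf : `|chi x * u x - W x| <= e1.
  rewrite /chi; case: ltP => dx.
    by have := fR _ dx xb; rewrite /f mulN1r mul1r.
  by rewrite W0 ?ax// mul0r subrr normr0 ltW.
(* Since [W d = 0], the atom does not contribute to [T W], which equals [T' W]. *)
have -> : T W x + c * W x - L u x = - (T' f x + c * (chi x * u x - W x)).
  rewrite Tchi// W0 ?ad ?lexx// mulr0 mulr0 addr0 /L primD// primZ//; ring.
rewrite normrN; apply: le_trans (ler_normD _ _) _.
rewrite normrM (gtr0_norm c0).
apply: le_trans (_ : K * e1 <= _); last by rewrite mulrC divfK ?gt_eqF.
have : c * `|chi x * u x - W x| <= c * e1 by rewrite ler_wpM2l// ltW.
rewrite (_ : K * e1 = 2 * B * e1 + e1 * G' b + c * e1 + e1); last by rewrite /K; ring.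
lra.
Qed.

Lemma gclosure_remove f : ucont D f -> gclosure D f.
Proof.
have gchi u : ucont D' u -> gclosure D (fun x => chi x * u x).
  move=> uu; apply: gclosure_supp_right; last first.
    by move=> x /andP[_ xd]; rewrite /chi ltNge xd mul0r.
  move=> e e0; have [t t0 H] := uu _ e0.
  exists (Num.min t c) => [|x y xab yab]; first by rewrite lt_min t0.
  rewrite lt_min => /andP[h /(Gjump xab yab) s].
  rewrite Gd// in h; rewrite /chi s; case: ifP => _.
    by rewrite !mul1r H.
  by rewrite !mul0r subrr normr0.
have gT' u : ucont D' u -> gclosure D (T' u).
  move=> uu; apply: gclosure_ext (gclosureD (L_gclosure uu) (gclosureZ (- c) (gchi u uu))).
  by move=> x _; rewrite /L; ring.
(* In the primitive case [gT'] applies directly, as g'-polynomials are G'-continuous. *)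
have gp' p : gpoly D' p -> gclosure D p.
  elim=> {p} [|p q _ gp _ gq|k p _ gp|p gp _|p q pq _ gp].
  - exact/gpoly_gclosure/gpoly_one.
  - exact: gclosureD.
  - exact: gclosureZ.
  - by apply: gT'; exact: gpoly_ucont gp.
  - exact: gclosure_ext gp.
have gu' u : ucont D' u -> gclosure D u.
  move=> uu; apply: gclosure_lim => e /(dense' uu)[p gp up].
  by exists p => //; exact: gp'.
move=> uf; pose mn x := Num.min x d.
have mnab x : a <= x <= b -> a <= mn x <= b.
  by move=> /andP[ax xb]; rewrite /mn le_min ax ad ge_min xb.
(* Up to [d], the functions [G] and [G'] coincide. *)
have uf1 : ucont D' (fun x => f (mn x)).
  move=> e /uf[t t0 H]; exists t => // x y xab yab h.
  apply: H; rewrite ?mnab//; apply: le_lt_trans h.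
  have mnd z : (d < mn z) = false by rewrite /mn lt_min ltxx andbF.
  rewrite Gd ?mnab ?mnd//.
  wlog xy : x y xab yab / x <= y.
    move=> W; case: (leP x y) => [|/ltW] xy; first exact: W.
    by rewrite distrC [leRHS]distrC; exact: W.
  move: (xab) (yab) => /andP[ax xb] /andP[ay yb].
  have mxy : mn x <= mn y by rewrite /mn le_min2.
  have axm : a <= mn x by case/andP: (mnab x xab).
  have ymb : mn y <= b by case/andP: (mnab y yab).
  rewrite distrC [leRHS]distrC !ger0_norm ?subr_ge0 ?gfun_nd//.
  rewrite /mn; case: (leP x d) => xd.
    rewrite lerD2r gfun_nd// ?ge_min ?lexx//.
    by rewrite le_min ay ad.
  by rewrite (min_idPr (ltW (lt_le_trans xd xy))) subrr subr_ge0 gfun_nd.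
have uf2 : ucont D (fun x => f x - f (mn x)).
  move=> e /uf[t t0 H]; exists (Num.min t c) => [|x y xab yab].
    by rewrite lt_min t0.
  rewrite lt_min => /andP[h /(Gjump xab yab) s].
  rewrite /mn; case: (leP x d) s => dx; case: (leP y d) => dy //= _.
    by rewrite !subrr normr0 (le_lt_trans (normr_ge0 _) (H _ _ xab yab h)).
  by rewrite opprB addrA subrK H.
apply: gclosure_ext (gclosureD (gu' _ uf1) (gclosure_supp_right uf2 _)).
  by move=> x _; rewrite addrC subrK.
by move=> x /andP[_ xd]; rewrite /mn (min_idPl xd) subrr.
Qed.

End RemoveAtom.

(** * Induction on the atoms *)

(** Density and decay are carried together, since restoring an atom uses both for the smaller
    domain. The list may contain points that are not atoms; these are skipped. *)
Lemma gpoly_dense_decay (s : seq R) D : measurable D ->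
  (forall x, a <= x < b -> atom D x != 0 -> x \in s) ->
  (forall f, ucont D f -> gclosure D f) /\ titer_decay D.
Proof.
elim: s D => [|d s IH] D mD hD.
  have na x : a <= x < b -> atom D x = 0.
    by move=> /hD h; apply/eqP/negPn/negP => /h.
  by split; [move=> f; exact: gclosure_base|exact: titer_decay_base].
have [/andP[/andP[ad db] Dd]|nd] := boolP ((a <= d < b) && (atom D d != 0)); last first.
  apply: IH => // x xab Dx; have := hD x xab Dx.
  rewrite inE => /orP[/eqP xd|//]; move: nd.
  by rewrite -xd xab Dx.
have Dd0 : 0 < atom D d by rewrite lt_neqAle eq_sym Dd fine_ge0.
have [|x xab|h1 h2] := IH (D `\ d).
- exact: measurableD.
- have [->|xd] := eqVneq x d.
    rewrite /atom (_ : _ `&` _ = set0) ?measure0 ?eqxx//.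
    by apply/seteqP; split => // t [/= -> [_ /=]].
  rewrite (_ : atom (D `\ d) x = atom D x) => [Dx|].
    by have := hD x xab Dx; rewrite inE (negbTE xd).
  rewrite /atom; congr (fine (mu _)); apply/seteqP; split => t [/= -> ].
    by move=> [].
  by move=> Dx; split => //; split => //=; exact/eqP.
split; last exact: (titer_decay_remove mD ad Dd0 h2).
by move=> f uf; exact: (gclosure_remove mD ad db Dd0 h1 h2 uf).
Qed.

(** * Return to g-monomials and to the derivator *)

(** Integrating the monomial of degree [n] centred at [a] gives the next one divided by [n + 1], so
    their span is stable under [prim setT]. *)
Lemma gpoly_gmono p : gpoly setT p -> exists s : seq (nat * R),
  forall x, a <= x <= b -> p x = \sum_(e <- s) e.2 * gmono mu a e.1 x.
Proof.
have gmR (s : seq (nat * R)) : (forall n, regular (gmono mu a n)) ->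
    regular (fun x => \sum_(e <- s) e.2 * gmono mu a e.1 x).
  move=> H; elim: s => [|e s IH].
    by apply: eq_regular (regular_cst 0) => x _; rewrite big_nil.
  have := regularD (regularM (regular_cst e.2) (H e.1)) IH.
  by apply: eq_regular => x _; rewrite big_cons.
have gmS n x : a <= x -> gmono mu a n.+1 x = n.+1%:R * prim setT (gmono mu a n) x.
  by move=> ax /=; rewrite ax /prim /icell setIT.
have gmreg n : regular (gmono mu a n).
  elim: n => [|n IH]; first exact: regular_cst.
  apply: (@eq_regular (fun x => n.+1%:R * prim setT (gmono mu a n) x)).
    by move=> x /andP[ax _]; rewrite gmS.
  by apply: regularM; [exact: regular_cst|exact: prim_regular].
elim=> {p} [|p q _ [s sp] _ [s' sq]|k p _ [s sp]|p gp [s sp]|p q pq _ [s sp]].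
- by exists [:: (0%N, 1)] => x _; rewrite big_seq1 mulr1.
- by exists (s ++ s') => x xab; rewrite big_cat/= sp// sq.
- exists [seq (e.1, k * e.2) | e <- s] => x xab.
  by rewrite sp// big_map mulr_sumr; apply: eq_bigr => e _; rewrite mulrA.
- exists [seq (e.1.+1, e.2 / e.1.+1%:R) | e <- s] => x xab.
  have [ax xb] := andP xab.
  rewrite (eq_prim setT xb sp) big_map {sp}; elim: s => [|e s IH].
    rewrite big_nil (@eq_prim _ _ (fun=> 0) _ xb) => [|t _]; last by rewrite big_nil.
    by rewrite prim_cst ?mul0r.
  rewrite big_cons -IH /= -/(gmono mu a e.1.+1 x) gmS// mulrA divfK ?pnatr_eq0//.
  have rZ : regular (fun t => e.2 * gmono mu a e.1 t).
    by apply: regularM => //; exact: regular_cst.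
  rewrite -(primZ measurableT _ xb (gmreg _)) -(primD measurableT xb rZ (gmR _ gmreg)).
  by apply: (eq_prim setT xb) => t _; rewrite big_cons.
- by exists s => x xab; rewrite -pq ?sp.
Qed.

End StieltjesIntegration.

Section DerivatorMeasure.
Context (R : realType) (a b : R) (g : R -> R) (mu : {measure set R -> \bar R}).
Hypothesis le_ab : a <= b.
Hypothesis gD : forall c d, a <= c -> c < d -> d <= b ->
  mu [set` `[c, d[] = (g d - g c)%:E.

Lemma stieltjes_fin : (mu [set` `[a, b[] < +oo)%E.
Proof.
move: le_ab; rewrite le_eqVlt => /orP[/eqP <-|ab]; last by rewrite gD// ltry.
by rewrite set_itvco0 measure0.
Qed.

Lemma gfun_stieltjes x : a <= x <= b -> gfun a mu setT x = g x - g a.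
Proof.
move=> /andP[ax xb]; rewrite /gfun /mass /icell setIT.
move: ax; rewrite le_eqVlt => /orP[/eqP <-|ax]; last by rewrite gD.
by rewrite set_itvco0 measure0 subrr.
Qed.

(** An atom at [x] is at most [g y - g x] for every [y] in [(x, b]], which continuity at [x] makes
    arbitrarily small. *)
Lemma atom_discont x : a <= x < b -> atom mu setT x != 0 -> discont_points a b g x.
Proof.
move=> /andP[ax xb] /eqP ax0; split; first by rewrite ax ltW.
move=> cg; apply: ax0.
have A0 : 0 <= atom mu setT x by exact: fine_ge0.
apply/eqP; rewrite eq_le A0 andbT leNgt; apply/negP => A1.
move/cvgrPdist_lt : cg => /(_ _ A1) [r /= r0 H].
pose y := Num.min b (x + r / 2).
have xy : x < y by rewrite /y lt_min xb ltrDl divr_gt0.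
have yb : y <= b by rewrite /y ge_min lexx.
have yr : y <= x + r / 2 by rewrite /y ge_min lexx orbT.
have : `|g x - g y| < atom mu setT x.
  apply: H; last by rewrite /= in_itv/= yb (le_trans ax (ltW xy)).
  by rewrite /ball/= distrC gtr0_norm ?subr_gt0//; lra.
have : mass mu setT x y = g y - g x by rewrite /mass /icell setIT gD.
rewrite (mass_remove stieltjes_fin measurableT ax (lexx _) xy yb).
have := mass_ge0 mu (setT `\ x) x y.
rewrite ltr_norml; move: A0; lra.
Qed.

End DerivatorMeasure.

(** * The real case, then the complex one *)

Lemma dense_gpolyR (R : realType) (a b : R) (g : R -> R)
  (mu : {measure set R -> \bar R}) :
  a <= b ->
  finite_set (discont_points a b g) ->
  (forall c d, a <= c -> c < d -> d <= b -> mu [set` `[c, d[] = (g d - g c)%:E) ->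
  forall f : R -> R, unif_g_contR a b g f ->
     forall eps : R, 0 < eps -> exists2 p : R -> R, is_gpolyR mu a b p &
       forall x, a <= x <= b -> `|f x - p x| <= eps.
Proof.
move=> ab /finite_seqP[s sE] gD f uf e e0.
have mf := stieltjes_fin ab gD.
have [||dense _] := @gpoly_dense_decay R a b mu ab mf s setT; first exact: measurableT.
  by move=> x xab Ax; have := atom_discont ab gD xab Ax; rewrite sE.
have [|p gp fp] := dense f _ e e0.
  move=> t /uf[d d0 H]; exists d => // x y xab yab h; apply: H => //.
  by move: h; rewrite !(gfun_stieltjes gD)// opprB addrA subrK.
have [s' sp] := gpoly_gmono ab mf gp.
exists (fun x => \sum_(e <- [seq (a, i.1, i.2) | i <- s']) e.2 * gmono mu e.1.1 e.1.2 x).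
  exists [seq (a, i.1, i.2) | i <- s']; split => // _ /mapP[i _ ->] /=.
  by rewrite lexx.
by move=> x xab; rewrite big_map/= -sp// fp.
Qed.

Lemma normc_le_ReIm (R : realType) (z : R[i]) :
  `|z| <= (`|complex.Re z| + `|complex.Im z|)%:C%C.
Proof.
rewrite normc_def lecR -[leRHS]ger0_norm ?addr_ge0// -sqrtr_sqr ler_sqrt ?sqr_ge0//.
rewrite sqrrD !real_normK ?num_real// lerD2r lerDl mulrn_wge0// mulr_ge0//.
Qed.

Lemma normc_ge_Im (R : realType) (z : R[i]) : `|complex.Im z|%:C%C <= `|z|.
Proof.
rewrite normc_def lecR -sqrtr_sqr ler_sqrt ?addr_ge0 ?sqr_ge0//.
by rewrite lerDr sqr_ge0.
Qed.

Theorem mainTheorem15 (R : realType) (a b : R) (g : R -> R)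
  (mu : {measure set R -> \bar R}) :
  derivator a b g ->
  finite_set (discont_points a b g) ->
  (forall c d, a <= c -> c < d -> d <= b -> mu [set` `[c, d[] = (g d - g c)%:E) ->
  (forall f : R -> R, unif_g_contR a b g f ->
     forall eps : R, 0 < eps -> exists2 p : R -> R, is_gpolyR mu a b p &
       forall x, a <= x <= b -> `|f x - p x| <= eps) /\
  (forall f : R -> R[i], unif_g_contC a b g f ->
     forall eps : R, 0 < eps -> exists2 p : R -> R[i], is_gpolyC mu a b p &
       forall x, a <= x <= b -> `|f x - p x| <= eps%:C%C).
Proof.
(* If [b < a] the interval is empty and the zero polynomial serves. *)
move=> _ fin gD; have [ab|ba] := leP a b; last first.
  have empty x : (a <= x <= b) = false.
    by apply/negP => /andP[ax xb]; move: ba; rewrite ltNge (le_trans ax xb).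
  split=> f _ e _.
    by exists (fun=> 0) => [|x]; [exists [::]; split => // x; rewrite big_nil|rewrite empty].
  by exists (fun=> 0) => [|x]; [exists [::]; split => // x; rewrite big_nil|rewrite empty].
have dense := dense_gpolyR ab fin gD.
split=> // f uf e e0; have e20 : 0 < e / 2 by rewrite divr_gt0.
have [|p [s [sab pE]] fp] := dense (fun x => complex.Re (f x)) _ _ e20.
  move=> t /uf[d d0 H]; exists d => // x y xab yab /(H _ _ xab yab) h.
  by rewrite -ltcR; apply: le_lt_trans h; rewrite -raddfB normc_ge_Re.
have [|q [s' [sab' qE]] fq] := dense (fun x => complex.Im (f x)) _ _ e20.
  move=> t /uf[d d0 H]; exists d => // x y xab yab /(H _ _ xab yab) h.
  by rewrite -ltcR; apply: le_lt_trans h; rewrite -raddfB normc_ge_Im.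
(* Real and imaginary parts are approximated within [e / 2] each, then recombined with complex
   coefficients. *)
pose S := [seq (i.1, (i.2)%:C%C) | i <- s] ++ [seq (i.1, 'i%C * (i.2)%:C%C) | i <- s'].
have SE x : \sum_(i <- S) i.2 * (gmono mu i.1.1 i.1.2 x)%:C%C = (p x +i* q x)%C.
  rewrite [RHS]complexE /= pE qE /S big_cat !big_map /= !rmorph_sum mulr_sumr.
  by congr (_ + _); apply: eq_bigr => i _; rewrite rmorphM// mulrA.
exists (fun x => (p x +i* q x)%C).
  exists S; split; last by move=> x; rewrite SE.
  by move=> i; rewrite mem_cat => /orP[] /mapP[j js ->] /=; [exact: sab|exact: sab'].
move=> x xab; apply: le_trans (normc_le_ReIm _) _; rewrite lecR !raddfB /=.
by have := fp x xab; have := fq x xab; lra.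
Qed.
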